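(* Let $\sigma:\mathbb{R}\to\mathbb{R}$ satisfy the diffusion-coefficient assumption (with exponent $0\le\gamma\le 1/2$) and let $\mathfrak{C}_0:\mathbb{R}\to\mathbb{R}$ satisfy the initial-condition assumption, both given in the context. Then there exists a unique classical solution $\mathfrak{C}$ of the Cauchy problem $$\frac{\partial \mathfrak{C}}{\partial t}(t,q) = \frac12\sigma^2(q)\frac{\partial^2\mathfrak{C}}{\partial q^2}(t,q),\qquad \mathfrak{C}(0,q)=\mathfrak{C}_0(q),\qquad (t,q)\in\mathbb{R}_+\times\mathbb{R},$$ which is smooth and bounded. Moreover, for all $n\ge 1$, there exists a non-negative function $K_n\in\mathcal{C}^0(\mathbb{R}_+)$ such that $$\forall (t,q)\in\mathbb{R}_+\times\mathbb{R},\qquad \left|\frac{\partial^n\mathfrak{C}}{\partial q^n}(t,q)\right|\le K_n(t)\,|q|^{-n\gamma/2}.$$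
   Context: $\mathbb{R}_+=[0,+\infty)$. Diffusion-coefficient assumption: $\sigma$ is a smooth positive function on $\mathbb{R}$ with bounded derivatives. Moreover $\sigma(q)=\sigma_0(q)\sigma_{\mathrm b}(q)$, where $\sigma_0(q)=|q|^{\gamma/2}$ for $|q|\ge 1$, for some $0\le\gamma\le 1/2$, and $\sigma_{\mathrm b}$ is a bounded smooth function with bounded derivatives for which there exist $\delta_-,\delta_+>0$ such that $\delta_-\le\sigma_{\mathrm b}(q)\le\delta_+$ for all $q$. Finally, for any $n\ge1$ there exists $S_n\in\mathbb{R}_+$ such that $|\sigma^{(n)}(q)|\le S_n|q|^{\gamma/2-n}$ for $|q|\ge1$. Initial-condition assumption: $\mathfrak{C}_0$ is a smooth bounded function on $\mathbb{R}$ and, for all $n\ge1$, there is a constant $R_n\in\mathbb{R}_+$ such that $\|\mathfrak{C}_0^{(n)}\sigma_0^n\|_{\mathcal{C}^0}\le R_n$, where $\|\cdot\|_{\mathcal{C}^0}$ is the supremum norm on $\mathbb{R}$. *)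

(* Defs.v *)
From HB Require Import structures.
From mathcomp Require Import all_boot all_order all_algebra.
From mathcomp Require Import all_classical all_reals all_analysis.
Set Implicit Arguments.
Unset Strict Implicit.
Unset Printing Implicit Defensive.
Import Order.TTheory GRing.Theory Num.Theory.
Import numFieldNormedType.Exports.
Local Open Scope classical_set_scope.
Local Open Scope ring_scope.

Definition smooth1 (R : realType) (f : R -> R) : Prop :=
  forall (n : nat) (x : R), derivable (derive1n n f) x 1.

Definition bounded_derivatives (R : realType) (f : R -> R) : Prop :=
  forall n : nat, (0 < n)%N -> bounded_fun (derive1n n f).

(* sigma0 is exposed as a parameter because the assumption on the initial
   condition refers to it. *)
Record diffusion_coefficient (R : realType) (gamma : R)
    (sigma sigma0 sigmab : R -> R) : Prop := DiffusionCoefficient {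
  sigma_smooth : smooth1 sigma;
  sigma_gt0 : forall q, 0 < sigma q;
  sigma_bounded_derivatives : bounded_derivatives sigma;
  gamma_ge0 : 0 <= gamma;
  gamma_le_half : gamma <= 2^-1;
  sigma_factor : forall q, sigma q = sigma0 q * sigmab q;
  sigma0_power : forall q, 1 <= `|q| -> sigma0 q = `|q| `^ (gamma / 2);
  sigmab_smooth : smooth1 sigmab;
  sigmab_bounded : bounded_fun sigmab;
  sigmab_bounded_derivatives : bounded_derivatives sigmab;
  sigmab_bounds : exists delta_m delta_p : R,
    [/\ 0 < delta_m, 0 < delta_p & forall q, delta_m <= sigmab q <= delta_p];
  sigma_derivative_decay : forall n : nat, (0 < n)%N ->
    exists2 S : R, 0 <= S & forall q, 1 <= `|q| ->
      `|derive1n n sigma q| <= S * `|q| `^ (gamma / 2 - n%:R) }.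

Record initial_condition (R : realType) (sigma0 C0 : R -> R) : Prop :=
  InitialCondition {
  initial_smooth : smooth1 C0;
  initial_bounded : bounded_fun C0;
  initial_weighted_derivatives : forall n : nat, (0 < n)%N ->
    exists2 B : R, 0 <= B & forall q, `|derive1n n C0 q * sigma0 q ^+ n| <= B }.

(* A function of (t, q) is curried as F : R -> R -> R; only its values at
   times t >= 0 are meaningful. *)

(* The increments h are restricted to t + h >= 0, so that the time derivative
   is the usual one at t > 0 and the right derivative at t = 0; for t >= 0 it never
   involves values of F at negative times. *)
Definition time_quotient (R : realType) (F : R -> R -> R) (t q h : R) : R :=
  h^-1 * (F (t + h) q - F t q).

Definition time_increments (R : realType) (t : R) : set_system R :=
  within [set h | 0 <= t + h] 0^'.

Definition derivable_t (R : realType) (F : R -> R -> R) (t q : R) : Prop :=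
  cvg (time_quotient F t q @ time_increments t).

Definition partial_t (R : realType) (F : R -> R -> R) : R -> R -> R :=
  fun t q => lim (time_quotient F t q @ time_increments t).

Definition derivable_q (R : realType) (F : R -> R -> R) (t q : R) : Prop :=
  derivable (F t) q 1.

Definition partial_q (R : realType) (F : R -> R -> R) : R -> R -> R :=
  fun t q => derive1 (F t) q.

Definition jointly_continuous (R : realType) (I : set R) (F : R -> R -> R) :
    Prop :=
  {within I `*` [set: R], continuous (fun z : R * R => F z.1 z.2)}.

Fixpoint class_C (R : realType) (k : nat) (F : R -> R -> R) : Prop :=
  jointly_continuous `[0, +oo[ F /\
  if k is k'.+1 then
    [/\ forall t q, 0 <= t -> derivable_t F t q /\ derivable_q F t q,
        class_C k' (partial_t F) & class_C k' (partial_q F)]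
  else True.

(* Smoothness on [0, +oo[ x R, boundary t = 0 included: all the iterated
   partial derivatives, in any order, exist and are continuous. *)
Definition smooth (R : realType) (F : R -> R -> R) : Prop :=
  forall k : nat, class_C k F.

Definition solves_equation (R : realType) (sigma : R -> R) (F : R -> R -> R)
    (t q : R) : Prop :=
  partial_t F t q = 2^-1 * sigma q ^+ 2 * partial_q (partial_q F) t q.

(* C([0, +oo[ x R), C^{1,2} on ]0, +oo[ x R, with the equation for t > 0. *)
Record classical_solution (R : realType) (sigma C0 : R -> R)
    (F : R -> R -> R) : Prop := ClassicalSolution {
  solution_continuous : jointly_continuous `[0, +oo[ F;
  solution_derivable : forall t q, 0 < t ->
    [/\ derivable_t F t q, derivable_q F t q & derivable_q (partial_q F) t q];
  solution_C12 : [/\ jointly_continuous `]0, +oo[ (partial_t F),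
    jointly_continuous `]0, +oo[ (partial_q F)
    & jointly_continuous `]0, +oo[ (partial_q (partial_q F))];
  solution_equation : forall t q, 0 < t -> solves_equation sigma F t q;
  solution_initial : forall q, F 0 q = C0 q }.

Definition bounded_solution (R : realType) (F : R -> R -> R) : Prop :=
  [bounded F z.1 z.2 | z in `[0, +oo[ `*` [set: R]].

(* Main.v *)
(* Let A = (sigma^2 / 2) d^2/dq^2. Since sigma^2 = O(1 + q^2), comparison with
   eps (1 + q^2) shows that u - tau A u = f has at most one bounded solution for
   small tau, with |u| <= sup |f|. It exists: with X = sigma d/dq,
   (m - sigma' + X) (m - X) = m^2 - m sigma' - sigma^2 d^2/dq^2 is inverted by two
   first-order integrations, and the term m sigma' is absorbed by a contraction.
   The resolvents (1 - tau A)^-1 are thus commuting contractions of the bounded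
   continuous functions. As all A^n C0 are bounded, the implicit Euler scheme
   converges along tau_k = tau_0 / 2^k, because (1 - tau A)^-1 and
   (1 - tau/2 A)^-2 differ on f by at most (tau^2 / 4) sup |A^2 f|. The limits
   U_m(t) of the scheme started at A^m C0 satisfy A U_m = U_{m+1} and
   d/dt U_m = U_{m+1}, with sup |U_m(t)| <= sup |A^m C0|.
   Interpolation on intervals of length of order sigma(q) bounds sigma u' by u and
   A u, and then u'' = 2 sigma^-2 A u bounds every sigma^n u^(n) by u, ..., A^n u.
   Applied to U_m(t), to its increments in t and to its first-order Taylor remainders
   in t, this gives joint smoothness, and K_n may be taken constant in t. *)
Require Import Defs.
From HB Require Import structures.
From mathcomp Require Import all_boot all_order all_algebra.
From mathcomp Require Import all_classical all_reals all_analysis.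
From mathcomp Require Import ring lra.
Import Order.TTheory GRing.Theory Num.Theory.
Import numFieldNormedType.Exports.
Local Open Scope classical_set_scope.
Local Open Scope ring_scope.
Set Implicit Arguments.
Unset Strict Implicit.
Unset Printing Implicit Defensive.

(** * Differential calculus *)

Section Calculus.
Context {R : realType}.
Implicit Types (f g p r : R -> R) (x y q : R).

Definition has_derivative f f' : Prop := forall x, is_derive x (1 : R) f (f' x).

Lemma has_derivative_eq f f' f1 f1' : has_derivative f f' ->
  (forall x, f x = f1 x) -> (forall x, f' x = f1' x) -> has_derivative f1 f1'.
Proof. by move=> fP /funext <- /funext <-. Qed.

Lemma has_derivative_cst (c : R) : has_derivative (fun=> c) (fun=> 0).
Proof. by move=> x; exact: is_derive_cst. Qed.

Lemma has_derivative_id : has_derivative id (fun=> 1).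
Proof. by move=> x; exact: is_derive_id. Qed.

Lemma has_derivativeD f f' g g' : has_derivative f f' -> has_derivative g g' ->
  has_derivative (fun x => f x + g x) (fun x => f' x + g' x).
Proof. by move=> df dg x; apply: is_deriveD. Qed.

Lemma has_derivativeN f f' : has_derivative f f' ->
  has_derivative (fun x => - f x) (fun x => - f' x).
Proof. by move=> df x; apply: is_deriveN. Qed.

Lemma has_derivativeB f f' g g' : has_derivative f f' -> has_derivative g g' ->
  has_derivative (fun x => f x - g x) (fun x => f' x - g' x).
Proof. by move=> df dg x; apply: is_deriveB. Qed.

Lemma has_derivativeM f f' g g' : has_derivative f f' -> has_derivative g g' ->
  has_derivative (fun x => f x * g x) (fun x => f' x * g x + f x * g' x).
Proof.
move=> df dg x; have := is_deriveM (df x) (dg x).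
by rewrite addrC /GRing.scale /= [g x * _]mulrC.
Qed.

Lemma has_derivativeZ (c : R) f f' : has_derivative f f' ->
  has_derivative (fun x => c * f x) (fun x => c * f' x).
Proof. by move=> df x; exact: is_deriveZ. Qed.

Lemma has_derivativeV f f' : (forall x, f x != 0) -> has_derivative f f' ->
  has_derivative (fun x => (f x)^-1) (fun x => - f' x / f x ^+ 2).
Proof.
move=> f0 df x; have := is_deriveV (f0 x) (df x).
by rewrite /GRing.scale /= mulNr mulrC mulNr.
Qed.

Lemma has_derivative_comp f f' g g' : has_derivative f f' ->
  has_derivative g g' -> has_derivative (fun x => f (g x)) (fun x => f' (g x) * g' x).
Proof. by move=> df dg x; exact: (is_derive1_comp (df (g x)) (dg x)). Qed.

Lemma has_derivative_opp f f' : has_derivative f f' ->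
  has_derivative (fun x => f (- x)) (fun x => - f' (- x)).
Proof.
move=> df; apply: has_derivative_eq
  (has_derivative_comp df (has_derivativeN has_derivative_id)) _ _ => //=.
by move=> x; rewrite mulrN1.
Qed.

Lemma has_derivative_uniq f f1 f2 :
  has_derivative f f1 -> has_derivative f f2 -> f1 = f2.
Proof.
by move=> d1 d2; apply/funext => x; rewrite -(@derive_val _ _ _ _ _ _ _ (d1 x))
  -(@derive_val _ _ _ _ _ _ _ (d2 x)).
Qed.

Lemma is_derive_continuous f (d : R) x : is_derive x (1 : R) f d -> {for x, continuous f}.
Proof. by move=> [df _]; exact/differentiable_continuous/derivable1_diffP. Qed.

Lemma has_derivative_continuous f f' : has_derivative f f' -> continuous f.
Proof. by move=> df x; exact: is_derive_continuous (df x). Qed.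

Lemma mean_value f f' x y : has_derivative f f' ->
  exists2 c, `|c - x| <= `|y - x| & f y - f x = f' c * (y - x).
Proof.
move=> df; have [xy|yx] := leP x y.
- have [||c /itvP cxy ->] := @MVT_segment _ f f' x y xy.
  + by move=> ? _; exact: df.
  + exact/continuous_subspaceT/has_derivative_continuous/df.
  by exists c => //; rewrite !ger0_norm ?subr_ge0 ?lerD2r ?cxy.
- have [||c /itvP cxy E] := @MVT_segment _ f f' y x (ltW yx).
  + by move=> ? _; exact: df.
  + exact/continuous_subspaceT/has_derivative_continuous/df.
  exists c; last by rewrite -opprB E -mulrN opprB.
  have [yc cx] : y <= c /\ c <= x by rewrite !cxy.
  by rewrite !ler0_norm; lra.
Qed.

Lemma has_derivative_nondecreasing f f' : has_derivative f f' ->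
  (forall x, 0 <= f' x) -> {homo f : x y / x <= y}.
Proof.
move=> df f'0 x y xy; have [c _ E] := mean_value x y df.
by rewrite -subr_ge0 E mulr_ge0 // subr_ge0.
Qed.

(** Additive form of differentiability: no quotient, so [h = 0] is allowed and the remainder enters
    linear arithmetic directly. *)
Lemma is_derive_epsP f (d : R) x : is_derive x (1 : R) f d <->
  forall e, 0 < e -> exists2 dl, 0 < dl &
    forall h, `|h| < dl -> `|f (x + h) - f x - d * h| <= e * `|h|.
Proof.
have E h : h != 0 -> `|d - h^-1 *: (f (h *: 1%R + x) - f x)| =
    `|f (x + h) - f x - d * h| / `|h|.
  move=> h0; rewrite -normfV -normrM distrC /GRing.scale /= mulr1 [h + x]addrC.
  by congr `|_|; field.
split=> [[df dE]|H].
- have := df; rewrite /derivable => /cvg_ex [l lP].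
  have dl : d = l by rewrite -dE; exact: cvg_lim lP.
  rewrite -dl in lP => e e0; have /cvgrPdist_le /(_ _ e0) := lP.
  rewrite near_withinE => /nbhs_ballP [dl0 /= dl0_gt0 H].
  exists dl0 => // h hd; have [->|h0] := eqVneq h 0.
    by rewrite addr0 subrr mulr0 subr0 !normr0 mulr0.
  have /H/(_ h0) : ball (0 : R) dl0 h by rewrite /ball /= sub0r normrN.
  by rewrite E // ler_pdivrMr // normr_gt0.
- have lP : (fun h => h^-1 *: ((f \o shift x) (h *: (1 : R)) - f x)) @ 0^' --> d.
    apply/cvgrPdist_le => e e0; rewrite near_withinE.
    have [dl dl0 dlP] := H e e0.
    apply/nbhs_ballP; exists dl => //= h; rewrite /ball /= sub0r normrN => hd h0.
    by rewrite E // ler_pdivrMr ?normr_gt0 // dlP.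
  split; first by apply/cvg_ex; exists d.
  exact: cvg_lim lP.
Qed.

(** If [r > 0], then [p], which vanishes at [q], is positive just to the right of [q], and the mean
    value theorem gives [f] a value above [f q]. *)
Lemma second_derivative_at_max f p (r : R) q : has_derivative f p ->
  is_derive q (1 : R) p r -> (forall x, f x <= f q) -> p q = 0 /\ r <= 0.
Proof.
move=> df dp fq.
have p0 : p q = 0.
  have dq := df q.
  have d0 : is_derive q (1 : R) f 0.
    apply: (@derive1_at_max _ f (q - 1) (q + 1)).
    - by lra.
    - by move=> t _; case: (df t).
    - by rewrite in_itv /=; apply/andP; split; lra.
    - by move=> t _; exact: fq.
  by rewrite -(@derive_val _ _ _ _ _ _ _ dq) (@derive_val _ _ _ _ _ _ _ d0).
split=> //; rewrite leNgt; apply/negP => r0.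
have r20 : 0 < r / 2 by lra.
have [dl dl0 H] := (is_derive_epsP p r q).1 dp _ r20.
have dl2 : q < q + dl / 2 by lra.
have [c /itvP cq E] : exists2 c, c \in `]q, (q + dl / 2)[%R &
    f (q + dl / 2) - f q = p c * (q + dl / 2 - q).
  apply: MVT dl2 _ _ => [x _|]; first exact: df.
  exact/continuous_subspaceT/has_derivative_continuous/df.
have cgt : q < c by rewrite cq.
have clt : c < q + dl / 2 by rewrite cq.
have pc : 0 < p c.
  have nc : `|c - q| = c - q by rewrite ger0_norm // subr_ge0 ltW.
  have /H : `|c - q| < dl by rewrite nc; lra.
  rewrite nc (_ : q + (c - q) = c) ?p0; last by ring.
  rewrite subr0 ler_norml => /andP[+ _].
  have : 0 < r / 2 * (c - q) by rewrite mulr_gt0 // subr_gt0.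
  by lra.
have : 0 < f (q + dl / 2) - f q by rewrite E mulr_gt0 // subr_gt0.
by have := fq (q + dl / 2); lra.
Qed.

End Calculus.

(** * Limits, antiderivatives and the elliptic maximum principle *)

Section Limits.
Context {R : realType}.
Implicit Types (f g p r : R -> R) (x y q : R).

Lemma continuous_addf f g : continuous f -> continuous g ->
  continuous (fun q => f q + g q).
Proof. by move=> cf cg x; exact: cvgD (cf x) (cg x). Qed.

Lemma continuous_oppf f : continuous f -> continuous (fun q => - f q).
Proof. by move=> cf x; exact: cvgN (cf x). Qed.

Lemma continuous_mulf f g : continuous f -> continuous g ->
  continuous (fun q => f q * g q).
Proof. by move=> cf cg x; exact: cvgM (cf x) (cg x). Qed.

Lemma continuous_expf f n : continuous f -> continuous (fun q => f q ^+ n).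
Proof.
move=> cf; elim: n => [|n IH].
  by under eq_fun do rewrite expr0; exact: cst_continuous.
by under eq_fun do rewrite exprS; exact: continuous_mulf.
Qed.

Lemma continuous_invf f : (forall q, f q != 0) -> continuous f ->
  continuous (fun q => (f q)^-1).
Proof. by move=> f0 cf x; exact: cvgV (f0 x) (cf x). Qed.

(** Nested intervals: [u n - 2 C / 2^n] increases and [u n + 2 C / 2^n] decreases, and the limit is
    the supremum of the lower ends. *)
Lemma geometric_cauchy (u : nat -> R) (C : R) :
  (forall n, `|u n.+1 - u n| <= C / 2 ^+ n) ->
  exists l, forall n, `|l - u n| <= 2 * C / 2 ^+ n.
Proof.
move=> uC.
have C0 : 0 <= C by have := le_trans (normr_ge0 _) (uC 0%N); rewrite expr0 divr1.
have E2 n : C / 2 ^+ n.+1 = C / 2 ^+ n / 2.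
  by rewrite exprSr invfM mulrA.
pose lo n := u n - 2 * C / 2 ^+ n.
pose hi n := u n + 2 * C / 2 ^+ n.
have E n : 2 * C / 2 ^+ n = 2 * (C / 2 ^+ n) by rewrite mulrA.
have los n : lo n <= lo n.+1.
  rewrite /lo !E E2; have := uC n; rewrite ler_norml => /andP[+ _]; lra.
have his n : hi n.+1 <= hi n.
  rewrite /hi !E E2; have := uC n; rewrite ler_norml => /andP[_]; lra.
have lon : {homo lo : n m / (n <= m)%N >-> n <= m}.
  by apply: homo_leq => //; exact: le_trans.
have hin : {homo hi : n m / (n <= m)%N >-> n >= m}.
  by apply: homo_leq => // a b c ab bc; exact: le_trans bc ab.
have lohi n m : lo n <= hi m.
  apply: le_trans (lon _ _ (leq_maxl n m)) _.
  apply: le_trans (hin _ _ (leq_maxr n m)).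
  rewrite /lo /hi; have : 0 <= 2 * C / 2 ^+ maxn n m.
    by rewrite divr_ge0 ?exprn_ge0 ?mulr_ge0.
  lra.
have slo : has_sup (range lo).
  by split; [exists (lo 0%N), 0%N | exists (hi 0%N) => _ [n _ <-]].
exists (sup (range lo)) => n.
have := sup_upper_bound slo (imageT lo n).
have : sup (range lo) <= hi n by apply: ge_sup; [exists (lo 0%N), 0%N | move=> _ [m _ <-]].
by rewrite /lo /hi ler_norml => ? ?; apply/andP; split; lra.
Qed.

Lemma small_half_pow (C e : R) : 0 < e -> exists n, C / 2 ^+ n <= e.
Proof.
move=> e0; pose n := Num.truncn (`|C| / e); exists n.
rewrite ler_pdivrMr ?exprn_gt0 // -ler_pdivrMl // mulrC.
apply: le_trans (_ : n.+1%:R <= _).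
  apply/ltW; apply: le_lt_trans (truncnS_gt _).
  by rewrite ler_pM2r ?invr_gt0 ?ler_norm.
by rewrite -natrX ler_nat ltn_expl.
Qed.

Lemma continuous_epsP f x : {for x, continuous f} <->
  forall e, 0 < e -> exists2 d, 0 < d & forall y, `|y - x| < d -> `|f y - f x| <= e.
Proof.
split=> [fx e e0|H].
- have /cvgrPdist_le /(_ _ e0) /nbhs_ballP [d /= d0 H] := fx.
  exists d => // y yd; rewrite distrC; apply: H.
  by rewrite /ball /= distrC.
- apply/cvgrPdist_le => e e0; have [d d0 dP] := H e e0.
  apply/nbhs_ballP; exists d => //= y; rewrite /ball /= => yx.
  by rewrite distrC dP // distrC.
Qed.

Lemma uniform_limit_continuous (u : nat -> R -> R) f (C : R) :
  (forall n, continuous (u n)) ->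
  (forall n x, `|f x - u n x| <= C / 2 ^+ n) -> continuous f.
Proof.
move=> uc uf x; apply/continuous_epsP => e e0.
have e3 : 0 < e / 3 by lra.
have [n nC] := small_half_pow C e3.
have [d d0 dP] := (continuous_epsP (u n) x).1 (uc n x) _ e3.
exists d => // y /dP; move: (le_trans (uf n x) nC) (le_trans (uf n y) nC).
by rewrite !ler_norml => /andP[? ?] /andP[? ?] /andP[? ?]; apply/andP; split; lra.
Qed.

(** The base point -1 leaves an overlap ]-1, 1[ with the reflected construction, so that an
    antiderivative on the whole line can be glued at 0. *)
Lemma right_antiderivative f : continuous f ->
  exists F : R -> R, forall x, -1 < x -> is_derive x (1 : R) F (f x).
Proof.
move=> cf; exists (fun x => \int[@lebesgue_measure R]_(t in [set` `[-1, x]]) (f t))%R.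
move=> x x1.
have xu : x < x + 1 by lra.
have fi : (@lebesgue_measure R).-integrable `[-1, x + 1] (EFin \o f).
  apply: continuous_compact_integrable; first exact: segment_compact.
  exact: continuous_subspaceT.
have [dF FE] := @continuous_FTC1_closed R f (-1) x (x + 1) xu fi x1 (cf x).
by split; [exact: dF | rewrite -derive1E FE].
Qed.

Lemma antiderivative f : continuous f -> exists F : R -> R, has_derivative F f.
Proof.
move=> cf.
have [F1 dF1] := right_antiderivative cf.
have cf2 : continuous (fun x => - f (- x)).
  move=> x; apply: continuousN; apply: continuous_comp; last exact: cf.
  exact: opp_continuous.
have [G dG] := right_antiderivative cf2.
pose F2 x := G (- x).
have dF2 x : x < 1 -> is_derive x (1 : R) F2 (f x).
  move=> x1; have h1 : is_derive (- x) (1 : R) G (- f x).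
    by rewrite -[in f x](opprK x); apply: dG; lra.
  by rewrite -[f x]opprK -mulrN1; exact: (is_derive1_comp h1 (is_deriveNid x 1)).
(* On the overlap [F1 - F2] has zero derivative; after normalisation at 0 the two branches coincide
   there, which makes the glued function differentiable at 0. *)
have cst x : -1 < x -> x < 1 -> F1 x - F2 x = F1 0 - F2 0.
  move=> x1 x2.
  have [|||c _] := @MVT_segment _ (fun y => F1 y - F2 y) (fun=> 0) (Num.min x 0) (Num.max x 0).
  - by rewrite ge_min !le_max !lexx.
  - move=> y; rewrite in_itv /= => /andP[]; rewrite gt_min lt_max => y1 y2.
    rewrite -(subrr (f y)); apply: is_deriveB; [apply: dF1|apply: dF2].
      by case/orP: y1; lra.
    by case/orP: y2; lra.
  - apply: continuous_in_subspaceT => y; rewrite inE /= in_itv /= => /andP[].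
    rewrite ge_min le_max => y1 y2.
    have ya : -1 < y by case/orP: y1; lra.
    have yb : y < 1 by case/orP: y2; lra.
    apply: continuousB; [exact: is_derive_continuous (dF1 y ya)|].
    exact: is_derive_continuous (dF2 y yb).
  - by rewrite mul0r; have [x0|x0] := ltP x 0 => ?; lra.
exists (fun x => if x <= 0 then F2 x - F2 0 else F1 x - F1 0) => x.
have [x0|x0] := leP x 0.
- apply: near_eq_is_derive (_ : is_derive x 1 (fun y => F2 y - F2 0) _).
    near=> y; case: ifPn => // y0.
    have : y < 1 by near: y; apply: lt_nbhsl; lra.
    have : - 1 < y by rewrite -ltNge in y0; lra.
    by move=> /cst /[apply]; lra.
  by rewrite -[f x]subr0; apply: is_deriveB; apply: dF2; lra.
- apply: near_eq_is_derive (_ : is_derive x 1 (fun y => F1 y - F1 0) _).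
    near=> y; rewrite leNgt ifF //; apply/negbF; near: y.
    exact: lt_nbhsr.
  by rewrite -[f x]subr0; apply: is_deriveB; apply: dF1; lra.
Unshelve. all: by end_near. Qed.

(* The antiderivative vanishing at -oo, obtained as G0 - inf (G0 + Phi). *)
Lemma dominated_antiderivative Phi Phi' H : has_derivative Phi Phi' ->
  (forall x, 0 < Phi x) -> continuous H -> (forall x, `|H x| <= Phi' x) ->
  exists2 G, has_derivative G H & forall x, `|G x| <= Phi x.
Proof.
move=> dPhi Phi0 cH HP; have [G0 dG0] := antiderivative cH.
have up : {homo (fun x => G0 x + Phi x) : x y / x <= y}.
  apply: has_derivative_nondecreasing (has_derivativeD dG0 dPhi) _ => x.
  by have := HP x; rewrite ler_norml => /andP[? ?]; lra.
have dn : {homo (fun x => Phi x - G0 x) : x y / x <= y}.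
  apply: has_derivative_nondecreasing (has_derivativeB dPhi dG0) _ => x.
  by have := HP x; rewrite ler_norml => /andP[? ?]; lra.
pose S := range (fun x => G0 x + Phi x).
(* Subtracting from [G0] any constant between all values of [G0 - Phi] and all values of [G0 + Phi]
   gives an antiderivative bounded by [Phi]. *)
have lb x y : G0 x - Phi x <= G0 y + Phi y.
  have px := Phi0 x; have py := Phi0 y.
  by have [/up|/ltW/dn] := leP x y => /=; lra.
have iS : has_inf S.
  by split; [exists (G0 0 + Phi 0), 0 | exists (G0 0 - Phi 0) => _ [y _ <-]].
exists (fun x => G0 x - inf S).
  by apply: has_derivative_eq (has_derivativeB dG0 (has_derivative_cst (inf S))) _ _ => //= x; rewrite subr0.
move=> x; have := inf_lbound iS.2 (imageT (fun x => G0 x + Phi x) x).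
have : G0 x - Phi x <= inf S by apply: lb_le_inf; [exact: iS.1 | move=> _ [y _ <-]].
by rewrite ler_norml => ? ?; apply/andP; split; lra.
Qed.

(** Reflection of the increasing case: the integration now starts from +oo. *)
Lemma dominated_antiderivative_decr Phi Phi' H : has_derivative Phi Phi' ->
  (forall x, 0 < Phi x) -> continuous H -> (forall x, `|H x| <= - Phi' x) ->
  exists2 G, has_derivative G H & forall x, `|G x| <= Phi x.
Proof.
move=> dPhi Phi0 cH HP.
have [|||G dG GP] := @dominated_antiderivative _ _ (fun x => - H (- x))
    (has_derivative_opp dPhi).
- by move=> x; exact: Phi0.
- move=> x; apply: continuousN; apply: continuous_comp; last exact: cH.
  exact: opp_continuous.
- by move=> x; rewrite normrN.
exists (fun x => G (- x)); last by move=> x; rewrite -[x in Phi x]opprK.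
by apply: has_derivative_eq (has_derivative_opp dG) _ _ => // x; rewrite !opprK.
Qed.

(* Compare u with the barrier c + eps (1 + q^2) at a maximum point of the
   difference, which exists because u is bounded. *)
Lemma elliptic_max_principle u p r (a : R -> R) (N c : R) :
  has_derivative u p -> has_derivative p r -> (forall q, `|u q| <= N) ->
  (forall q, 0 <= a q) -> (forall q, 2 * a q <= 1 + q ^+ 2) ->
  (forall q, u q <= c + a q * r q) -> forall q, u q <= c.
Proof.
move=> du dp uN a0 aw ule q; apply/ler_addgt0Pr => e e0.
(* With this coefficient the barrier costs exactly [e] at the point [q]. *)
pose d := e / (1 + q ^+ 2).
have w0 (x : R) : 0 < 1 + x ^+ 2 by have := sqr_ge0 x; lra.
have d0 : 0 < d by rewrite divr_gt0.
suff H x : u x - d * (1 + x ^+ 2) <= c.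
  by have := H q; rewrite /d divfK ?gt_eqF //; lra.
pose f x := u x - d * (1 + x ^+ 2).
have dw : has_derivative (fun x => 1 + x ^+ 2) (fun x => 2 * x).
  apply: has_derivative_eq (has_derivativeD (has_derivative_cst 1)
    (has_derivativeM has_derivative_id has_derivative_id)) _ _ => y //=.
  ring.
have df : has_derivative f (fun x => p x - d * (2 * x)).
  exact: has_derivativeB du (has_derivativeZ d dw).
have ddf : has_derivative (fun x => p x - d * (2 * x)) (fun x => r x - d * 2).
  apply: has_derivative_eq (has_derivativeB dp
    (has_derivativeZ d (has_derivativeZ 2 has_derivative_id))) _ _ => y //=.
  ring.
(* Since [Q >= 1], beyond [Q] one has [d y^2 >= d Q >= 2 N], hence [f y <= f 0]: the maximum over
   the segment is global. *)
pose Q := Num.max 1 (2 * N / d).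
have Q1 : 1 <= Q by rewrite le_max lexx.
have QN : 2 * N <= d * Q.
  by rewrite [d * _]mulrC -ler_pdivrMr // le_max lexx orbT.
have [|m mQ mP] := @EVT_max _ f (- Q) Q _ (continuous_subspaceT (has_derivative_continuous df)).
  lra.
have fm y : f y <= f m.
  have [yQ|] := boolP (y \in `[- Q, Q]%R); first exact: mP.
  rewrite in_itv /= -ler_norml -ltNge => yQ.
  have f0 : f 0 <= f m by apply: mP; rewrite in_itv /=; apply/andP; split; lra.
  apply: le_trans f0; rewrite /f expr0n /=.
  have : d * Q <= d * y ^+ 2.
    rewrite ler_pM2l // -real_normK ?num_real // expr2.
    by apply: le_trans (ltW yQ) _; rewrite ler_peMl // (le_trans Q1) // ltW.
  have := uN y; have := uN 0; rewrite !ler_norml => /andP[? ?] /andP[? ?].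
  lra.
have [pm rm] := second_derivative_at_max df (ddf m) fm.
apply: le_trans (fm x) _; rewrite /f.
(* At the maximum [r m <= 2 d], so the diffusion term is at most [2 d a m], which the barrier
   [d (1 + m^2)] absorbs. *)
have : a m * r m <= a m * (d * 2) by rewrite ler_wpM2l //; lra.
have : d * (2 * a m) <= d * (1 + m ^+ 2) by rewrite ler_wpM2l // ltW.
have := ule m; lra.
Qed.

End Limits.

(** * The resolvent *)

Section Resolvent.
Context {R : realType}.
Variables (s s' s2 : R -> R) (L : R).
Hypothesis s_gt0 : forall q, 0 < s q.
Hypothesis ds : has_derivative s s'.
Hypothesis ds' : has_derivative s' s2.
Hypothesis L_gt0 : 0 < L.
Hypothesis s'L : forall q, `|s' q| <= L.
Implicit Types (f g u v : R -> R) (x q : R).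

Definition BC f := continuous f /\ exists N, forall q, `|f q| <= N.

(* The graph of A = (s^2 / 2) d^2/dq^2: gen u g means that A u = g. *)
Definition gen u g := exists2 p, has_derivative u p &
  has_derivative p (fun q => 2 * g q / s q ^+ 2).

(** Constant of the quadratic growth of [s^2], obtained by squaring [s q <= s 0 + L |q|]. *)
Definition growth : R := 2 * (s 0 ^+ 2 + L ^+ 2).

Let s_neq0 q : s q != 0. Proof. by rewrite gt_eqF. Qed.

Let cs : continuous s. Proof. exact: has_derivative_continuous ds. Qed.

Let cs' : continuous s'. Proof. exact: has_derivative_continuous ds'. Qed.

Lemma growth_gt0 : 0 < growth.
Proof. by have := sqr_ge0 (s 0); have := exprn_gt0 2 L_gt0; rewrite /growth; lra. Qed.

Lemma sqr_le_growth q : s q ^+ 2 <= growth * (1 + q ^+ 2).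
Proof.
have [c _ E] := mean_value 0 q ds.
have s0 := s_gt0 0; have sq := s_gt0 q.
have : s q <= s 0 + L * `|q|.
  rewrite -(subrK (s 0) (s q)) E subr0 [leRHS]addrC lerD2r.
  apply: le_trans (ler_norm _) _; rewrite normrM.
  by rewrite ler_wpM2r.
move=> h; have {}h : s q ^+ 2 <= (s 0 + L * `|q|) ^+ 2.
  by rewrite ler_sqr // nnegrE; [exact: ltW | exact: le_trans (ltW sq) h].
apply: le_trans h _.
have -> : q ^+ 2 = `|q| ^+ 2 by rewrite real_normK ?num_real.
have := sqr_ge0 (s 0 - L * `|q|); have := sqr_ge0 L.
have := mulr_ge0 (sqr_ge0 (s 0)) (sqr_ge0 `|q|).
rewrite /growth; nra.
Qed.

Lemma BC_comb f g (a b : R) : BC f -> BC g -> BC (fun q => a * f q + b * g q).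
Proof.
move=> [cf [N fN]] [cg [M gM]]; split.
  by apply: continuous_addf; apply: continuous_mulf => //; exact: cst_continuous.
exists (`|a| * N + `|b| * M) => q; apply: le_trans (ler_normD _ _) _.
by rewrite !normrM lerD // ler_wpM2l.
Qed.

Lemma gen_comb u g v h (a b : R) : gen u g -> gen v h ->
  gen (fun q => a * u q + b * v q) (fun q => a * g q + b * h q).
Proof.
move=> [p du dp] [r dv dr]; exists (fun q => a * p q + b * r q).
  exact: has_derivativeD (has_derivativeZ a du) (has_derivativeZ b dv).
apply: has_derivative_eq (has_derivativeD (has_derivativeZ a dp) (has_derivativeZ b dr)) _ _ => // q.
ring.
Qed.

Lemma gen_eq u g u1 g1 : gen u g -> u =1 u1 -> g =1 g1 -> gen u1 g1.
Proof. by move=> ug /funext <- /funext <-. Qed.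

Lemma gen_continuous u g : gen u g -> continuous u.
Proof. by move=> [p du _]; exact: has_derivative_continuous du. Qed.

(** Elliptic principle with [a = t s^2 / 2]; the condition on [t * growth] is what gives
    [2 a <= 1 + q^2]. *)
Lemma gen_max_principle u g (t N c : R) : gen u g -> (forall q, `|u q| <= N) ->
  0 <= t -> t * growth <= 1 -> (forall q, u q - t * g q <= c) -> forall q, u q <= c.
Proof.
move=> [p du dp] uN t0 tg H; apply: (@elliptic_max_principle _ _ _ _
  (fun q => t / 2 * s q ^+ 2) _ _ du dp uN) => q.
- by rewrite mulr_ge0 ?sqr_ge0 // divr_ge0.
- have -> : 2 * (t / 2 * s q ^+ 2) = t * s q ^+ 2 by field.
  apply: le_trans (ler_wpM2l t0 (sqr_le_growth q)) _.
  by rewrite mulrA ler_piMl // addr_ge0 ?sqr_ge0.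
- have -> : t / 2 * s q ^+ 2 * (2 * g q / s q ^+ 2) = t * g q by field.
  by have := H q; lra.
Qed.

(** Contractivity of (1 - t A)^-1 in the supremum norm, from the one-sided principle applied to [u]
    and [- u]. *)
Lemma gen_bound u g (t N c : R) : gen u g -> (forall q, `|u q| <= N) ->
  0 <= t -> t * growth <= 1 -> (forall q, `|u q - t * g q| <= c) ->
  forall q, `|u q| <= c.
Proof.
move=> ug uN t0 tg H q; rewrite ler_norml; apply/andP; split; last first.
  apply: (gen_max_principle ug uN t0 tg) => x.
  by have := H x; rewrite ler_norml => /andP[].
rewrite lerNl.
have ug' : gen (fun q => - u q) (fun q => - g q).
  by apply: gen_eq (gen_comb (-1) 0 ug ug) _ _ => x; rewrite mul0r addr0 mulN1r.
apply: (gen_max_principle (N := N) ug' _ t0 tg) => x; first by rewrite normrN.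
by have := H x; rewrite ler_norml => /andP[? ?]; lra.
Qed.

(* Since (m - s' + X) (m - X) = m^2 - m s' - s^2 d^2/dq^2 for X = s d/dq, this
   equation is solved by two explicit first-order integrations. *)
Definition potential_sol (m : R) u g := exists2 p, has_derivative u p &
  has_derivative p (fun q => ((m ^+ 2 - m * s' q) * u q - g q) / s q ^+ 2).

(** With X = s d/dq, solve first (m - s' + X) v = g, then (m - X) u = v, by an integrating factor.
    Dominated antiderivatives give [|v| <= c / (m - L)] and [|u| <= c / (m (m - L))]. *)
Lemma potential_sol_exists (m c : R) g : L < m -> 0 < c -> continuous g ->
  (forall q, `|g q| <= c) -> exists2 u, potential_sol m u g & BC u.
Proof.
move=> Lm c0 cg gc; have m0 : 0 < m by exact: lt_trans Lm.
have mL : 0 < m - L by lra.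
have s2_neq0 q : s q ^+ 2 != 0 by rewrite expf_neq0.
have [y dy] : exists y : R -> R, has_derivative y (fun q => (s q)^-1).
  by apply: antiderivative; exact: continuous_invf.
(* Integrating factor: X E = m E, because [y] is an antiderivative of [1 / s]. *)
pose E q := expR (m * y q).
have dE : has_derivative E (fun q => m / s q * E q).
  have := has_derivative_comp (fun x => is_derive_expR x) (has_derivativeZ m dy).
  by move=> h; apply: has_derivative_eq h _ _ => // q; rewrite /E mulrC.
have E0 q : 0 < E q by exact: expR_gt0.
have En q : E q != 0 by rewrite gt_eqF.
have cE : continuous E by exact: has_derivative_continuous dE.
have dsV := has_derivativeV s_neq0 ds.
have dEV := has_derivativeV En dE.
pose c1 := c / (m - L).
have c10 : 0 < c1 by rewrite divr_gt0.
(* Here [G] is to be [E v / s]. The dominating function [c1 E / s] has derivative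
   [c1 (m - s') E / s^2], and [c1 (m - s') >= c] because [s' <= L]. *)
have [|||G dG GP] := @dominated_antiderivative _ _ _ (fun q => E q * g q / s q ^+ 2)
  (has_derivativeZ c1 (has_derivativeM dE dsV)).
- by move=> q; rewrite !mulr_gt0 ?invr_gt0.
- apply: continuous_mulf; first exact: continuous_mulf.
  by apply: continuous_invf => //; exact: continuous_mulf.
- move=> q; rewrite !normrM normfV (ger0_norm (ltW (E0 q))).
  rewrite (ger0_norm (sqr_ge0 _)).
  have -> : c1 * (m / s q * E q / s q + E q * (- s' q / s q ^+ 2)) =
    c1 * (m - s' q) * E q / s q ^+ 2 by field.
  rewrite ler_pM2r ?invr_gt0 ?exprn_gt0 // [leRHS]mulrC ler_pM2l //.
  apply: le_trans (gc q) _; rewrite /c1 -mulrAC ler_pdivlMr // ler_pM2l //.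
  by have := s'L q; rewrite ler_norml => /andP[_]; lra.
pose v q := s q * ((E q)^-1 * G q).
have vc q : `|v q| <= c1.
  rewrite /v !normrM normfV (gtr0_norm (s_gt0 q)) (gtr0_norm (E0 q)).
  rewrite mulrA -ler_pdivlMl ?divr_gt0 //.
  apply: le_trans (GP q) _; rewrite le_eqVlt; apply/orP; left; apply/eqP.
  by field; rewrite ?En ?s_neq0 ?(gt_eqF m0).
have dv : has_derivative v (fun q => (g q - (m - s' q) * v q) / s q).
  apply: has_derivative_eq (has_derivativeM ds (has_derivativeM dEV dG)) _ _ => // q.
  by rewrite /v; field; rewrite ?En ?s_neq0 ?(gt_eqF m0).
have cv : continuous v by exact: has_derivative_continuous dv.
clearbody v.
(* Here [H] is to be [u / E], whose derivative is [- v / (E s)]; the dominating function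
   [(c1 / m) / E] decreases, so the integration starts from +oo. *)
have [|||H dH HP] := @dominated_antiderivative_decr _ _ _
  (fun q => - ((E q)^-1 * v q / s q)) (has_derivativeZ (c1 / m) dEV).
- by move=> q; rewrite mulr_gt0 ?invr_gt0 // divr_gt0.
- apply: continuous_oppf; apply: continuous_mulf; last exact: continuous_invf.
  by apply: continuous_mulf => //; exact: continuous_invf.
- move=> q; rewrite normrN normrM [`|_ * v q|]normrM !normfV (gtr0_norm (s_gt0 q)) (gtr0_norm (E0 q)).
  have -> : - (c1 / m * (- (m / s q * E q) / E q ^+ 2)) = (E q)^-1 * c1 / s q.
    by field; rewrite ?En ?s_neq0 ?(gt_eqF m0).
  rewrite ler_pM2r ?invr_gt0 // ler_pM2l ?invr_gt0 //.
pose u q := E q * H q.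
have uc q : `|u q| <= c1 / m.
  rewrite /u normrM (gtr0_norm (E0 q)) -ler_pdivlMl //.
  by rewrite mulrC; exact: HP.
have du : has_derivative u (fun q => (m * u q - v q) / s q).
  apply: has_derivative_eq (has_derivativeM dE dH) _ _ => // q.
  by rewrite /u; field; rewrite ?En ?s_neq0 ?(gt_eqF m0).
exists u; last by split; [exact: has_derivative_continuous du | exists (c1 / m)].
exists (fun q => (m * u q - v q) / s q) => //.
apply: has_derivative_eq (has_derivativeM (has_derivativeB (has_derivativeZ m du) dv) dsV) _ _ => // q.
by field.
Qed.

(** Division by [m^2 - m s' >= m (m - L) > 0] gives u = g / (m^2 - m s') + a u'' with
    [a = s^2 / (m^2 - m s')]. The conditions on [m] yield [m^2 - m s' >= 2 m^2 / 3 >= 2 growth],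
    hence [2 a <= 1 + q^2]. *)
Lemma potential_sol_bound (m c : R) u g : 3 * L <= m -> 3 * growth <= m ^+ 2 ->
  potential_sol m u g -> (exists N, forall q, `|u q| <= N) ->
  (forall q, `|g q| <= c) -> forall q, `|u q| <= c / (m * (m - L)).
Proof.
move=> Lm gm uS [N uN] gc q.
have m0 : 0 < m by have := L_gt0; lra.
have mL : 0 < m - L by have := L_gt0; lra.
have VP x : m * (m - L) <= m ^+ 2 - m * s' x.
  by rewrite expr2 -mulrBr ler_pM2l // lerD2l lerN2; have := s'L x; rewrite ler_norml => /andP[].
have D0 : 0 < m * (m - L) by rewrite mulr_gt0.
have V0 x : 0 < m ^+ 2 - m * s' x by apply: lt_le_trans (VP x).
have c0 : 0 <= c by apply: le_trans (gc q).
have main (u1 g1 : R -> R) : potential_sol m u1 g1 -> (forall q, `|u1 q| <= N) ->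
    (forall q, `|g1 q| <= c) -> u1 q <= c / (m * (m - L)).
  move=> [p du dp] u1N g1c.
  apply: (@elliptic_max_principle _ _ _ _ (fun x => s x ^+ 2 / (m ^+ 2 - m * s' x)) N _ du dp) => // x.
  - by rewrite divr_ge0 ?sqr_ge0 // ltW.
  - rewrite mulrA ler_pdivrMr //.
    have h1 := sqr_le_growth x.
    have : growth * 2 <= m ^+ 2 - m * s' x.
      apply: le_trans (VP x); have : L * m <= m / 3 * m by apply: ler_wpM2r; [exact: ltW | lra].
      by lra.
    move=> /(ler_wpM2l (addr_ge0 ler01 (sqr_ge0 x))); lra.
  - have -> : s x ^+ 2 / (m ^+ 2 - m * s' x) *
      (((m ^+ 2 - m * s' x) * u1 x - g1 x) / s x ^+ 2) =
      u1 x - g1 x / (m ^+ 2 - m * s' x).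
      by field; rewrite s_neq0 (gt_eqF (V0 x)).
    have : g1 x / (m ^+ 2 - m * s' x) <= c / (m * (m - L)).
      apply: le_trans (_ : c / (m ^+ 2 - m * s' x) <= _).
        by rewrite ler_pM2r ?invr_gt0 //; apply: le_trans (ler_norm _) _.
      by rewrite ler_wpM2l // lef_pV2 ?posrE.
    lra.
rewrite ler_norml; apply/andP; split; last exact: (main u g).
rewrite lerNl; apply: (main (fun q => - u q) (fun q => - g q)); last 2 first.
- by move=> x; rewrite normrN.
- by move=> x; rewrite normrN.
case: uS => p du dp; exists (fun q => - p q); first exact: has_derivativeN.
apply: has_derivative_eq (has_derivativeN dp) _ _ => // x.
ring.
Qed.

Lemma potential_sol_sub (m : R) u g v h : potential_sol m u g ->
  potential_sol m v h -> potential_sol m (fun q => u q - v q) (fun q => g q - h q).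
Proof.
move=> [p du dp] [r dv dr]; exists (fun q => p q - r q); first exact: has_derivativeB.
by apply: has_derivative_eq (has_derivativeB dp dr) _ _ => // q; ring.
Qed.

(** A fixed point of the map [T], which solves the potential equation with right-hand side
    [m^2 f - m s' u], satisfies m^2 u - s^2 u'' = m^2 f. The ratio of [T] is at most
    [L / (m - L) <= 1/2] since [m >= 3 L]. *)
Lemma resolvent_exists (m : R) f : 3 * L <= m -> 3 * growth <= m ^+ 2 -> BC f ->
  exists2 u, gen u (fun q => m ^+ 2 / 2 * (u q - f q)) & BC u.
Proof.
move=> Lm gm [cf [N fN]].
have m0 : 0 < m by have := L_gt0; lra.
have Lm' : L < m by have := L_gt0; lra.
(* Outside [BC] the value of [T] is a dummy. *)
have /choice [T TP] : forall u, exists v, BC u ->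
    potential_sol m v (fun q => m ^+ 2 * f q - m * s' q * u q) /\ BC v.
  move=> u.
  have [[cu [M uM]]|nu] := pselect (BC u); last by exists u.
  have [||||v vs vb] := @potential_sol_exists m (m ^+ 2 * `|N| + m * L * `|M| + 1)
     (fun q => m ^+ 2 * f q - m * s' q * u q).
  - exact: Lm'.
  - rewrite ltr_wpDl // addr_ge0 // mulr_ge0 ?sqr_ge0 // mulr_ge0 //; exact: ltW.
  - apply: continuous_addf; last apply: continuous_oppf; apply: continuous_mulf => //.
      exact: cst_continuous.
    by apply: continuous_mulf => //; exact: cst_continuous.
  - move=> q; apply: le_trans (ler_normB _ _) _; rewrite !normrM !(gtr0_norm m0).
    have := ler_norm N; have := ler_norm M => ? ?.
    have h1 : m ^+ 2 * `|f q| <= m ^+ 2 * `|N|.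
      by rewrite ler_wpM2l ?sqr_ge0 //; apply: le_trans (fN q) _.
    have h2 : m * `|s' q| * `|u q| <= m * L * `|M|.
      apply: ler_pM => //; first exact: mulr_ge0 (ltW m0) _.
        by rewrite ler_pM2l.
      exact: le_trans (uM q) (ler_norm M).
    lra.
  by exists v.
pose u n := iter n T (fun=> 0).
have uBC n : BC (u n).
  elim: n => [|n IH]; last exact: (TP _ IH).2.
  by split; [exact: cst_continuous|exists 0 => q; rewrite normr0].
have contr (v w : R -> R) (c : R) : BC v -> BC w -> (forall q, `|v q - w q| <= c) ->
    forall q, `|T v q - T w q| <= c / 2.
  move=> bv bw vw q.
  have [Tv bTv] := TP v bv; have [Tw bTw] := TP w bw.
  have c0 : 0 <= c by apply: le_trans (vw q).
  apply: le_trans (_ : (m * L * c) / (m * (m - L)) <= _); last first.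
    rewrite ler_pdivrMr ?mulr_gt0 //; last by lra.
    have : L * (m * c) <= m / 3 * (m * c) by apply: ler_wpM2r; [exact: mulr_ge0 (ltW m0) c0 | lra].
    lra.
  apply: (potential_sol_bound (u := fun q => T v q - T w q) Lm gm (potential_sol_sub Tv Tw)).
    have [_ [M bM]] := BC_comb 1 (-1) bTv bTw; exists M => x.
    by have := bM x; rewrite mul1r mulN1r.
  move=> x; have -> : m ^+ 2 * f x - m * s' x * v x - (m ^+ 2 * f x - m * s' x * w x) =
     - (m * s' x * (v x - w x)) by ring.
  rewrite normrN !normrM (gtr0_norm m0).
  apply: ler_pM => //; first exact: mulr_ge0 (ltW m0) _.
  by rewrite ler_pM2l.
have [_ [C uC]] := uBC 1%N.
have step n q : `|u n.+1 q - u n q| <= C / 2 ^+ n.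
  elim: n q => [|n IH] q; first by rewrite [u 0%N]/= subr0 expr0 divr1.
  by rewrite exprSr invfM mulrA; exact: (contr (u n.+1) (u n) _ (uBC _) (uBC _) IH).
have /choice [w wP] : forall q, exists w, forall n, `|w - u n q| <= 2 * C / 2 ^+ n.
  by move=> q; apply: geometric_cauchy => n; exact: step.
have wBC : BC w.
  split; first by apply: (uniform_limit_continuous (fun n => (uBC n).1)) => n x; exact: wP.
  by exists (2 * C) => q; have := wP q 0%N; rewrite [u 0%N]/= subr0 expr0 divr1.
have [[p dw dp] _] := TP _ wBC.
(* Both [w] and [T w] are geometrically close to [u n.+1 = T (u n)]. *)
have Tw : T w = w.
  apply/funext => q; apply/eqP; rewrite -subr_eq0 -normr_le0.
  apply/ler_addgt0Pr => e e0; rewrite add0r.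
  have [n nP] := small_half_pow (4 * C) e0.
  have h1 := contr w (u n) _ wBC (uBC n) (fun x => wP x n) q.
  have h2 := wP q n.+1.
  rewrite -[T (u n)]/(u n.+1) in h1.
  have h3 := ler_distD (u n.+1 q) (T w q) (w q).
  rewrite [X in _ <= _ + X]distrC in h3.
  apply: le_trans h3 _; apply: le_trans (lerD h1 h2) _; apply: le_trans nP.
  rewrite exprSr invfM; set z := (2 ^+ n)^-1; have : 0 <= C * z.
    by rewrite mulr_ge0 ?invr_ge0 ?exprn_ge0 //; apply: le_trans (uC 0).
  lra.
exists w => //; rewrite Tw in dw dp; exists p => //.
by apply: has_derivative_eq dp _ _ => // q; field.
Qed.

(** For steps [t] up to this value, [m = sqrt (2 / t)] satisfies [m >= 3 L] and [m^2 >= 3 growth],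
    as the construction of the resolvent demands, and [t * growth <= 1], as the maximum principle
    demands. *)
Definition tau_max : R := (9 * L ^+ 2 + 3 * growth)^-1.

Lemma tau_max_gt0 : 0 < tau_max.
Proof.
by rewrite invr_gt0; have := growth_gt0; have := exprn_gt0 2 L_gt0; lra.
Qed.

Lemma tau_maxP (t : R) : 0 < t -> t <= tau_max ->
  [/\ t * growth <= 1, 3 * growth <= 2 / t & 9 * L ^+ 2 <= 2 / t].
Proof.
move=> t0 tt; have g0 := growth_gt0; have l0 := exprn_gt0 2 L_gt0.
have H : t * (9 * L ^+ 2 + 3 * growth) <= 1.
  by rewrite -ler_pdivlMr ?div1r //; lra.
have tg : 0 < t * growth by rewrite mulr_gt0.
have tl : 0 < t * L ^+ 2 by rewrite mulr_gt0.
by split; rewrite ?ler_pdivlMr //; lra.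
Qed.

Lemma heat_resolvent_exists (t : R) f : 0 < t -> t <= tau_max -> BC f ->
  exists2 u, gen u (fun q => (u q - f q) / t) & BC u.
Proof.
move=> t0 tt fBC; have [_ gt lt] := tau_maxP t0 tt.
have m2 : Num.sqrt (2 / t) ^+ 2 = 2 / t by rewrite sqr_sqrtr // divr_ge0 // ltW.
have [||u ug uBC] := @resolvent_exists (Num.sqrt (2 / t)) f _ _ fBC.
- rewrite -ler_sqr ?nnegrE ?sqrtr_ge0 ?mulr_ge0 ?(ltW L_gt0) // m2.
  by apply: le_trans lt; rewrite exprMn; lra.
- by rewrite m2.
exists u => //; apply: gen_eq ug _ _ => // q; rewrite m2.
by field; rewrite gt_eqF.
Qed.

End Resolvent.

(** * The semigroup *)

Section Semigroup.
Context {R : realType}.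
Variables (s : R -> R) (tm : R).
Hypothesis s_gt0 : forall q, 0 < s q.
Hypothesis tm_gt0 : 0 < tm.
Hypothesis accretive : forall u g (t N c : R), gen s u g ->
  (forall q, `|u q| <= N) -> 0 <= t -> t <= tm ->
  (forall q, `|u q - t * g q| <= c) -> forall q, `|u q| <= c.
Hypothesis range_full : forall (t : R) f, 0 < t -> t <= tm -> BC f ->
  exists2 u, gen s u (fun q => (u q - f q) / t) & BC u.
Implicit Types (f g u v : R -> R) (q : R).

Let step_ok (t : R) := 0 < t /\ t <= tm.

(** The resolvent (1 - t A)^-1, with the zero function as default where no bounded continuous
    solution exists. *)
Definition heat_res (t : R) f : R -> R :=
  xget (fun=> 0) [set u | gen s u (fun q => (u q - f q) / t) /\ BC u].

Local Notation J := heat_res.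

Lemma heat_resP t f : step_ok t -> BC f ->
  gen s (J t f) (fun q => (J t f q - f q) / t) /\ BC (J t f).
Proof.
move=> [t0 tt] fBC.
have [u ug uBC] := range_full t0 tt fBC.
rewrite /heat_res; case: xgetP => [v _ //|/(_ u)] /=; tauto.
Qed.

Lemma BC_sub f g : BC f -> BC g -> BC (fun q => f q - g q).
Proof.
move=> bf bg; have := BC_comb 1 (-1) bf bg.
by under [X in BC X -> _]eq_fun do rewrite mul1r mulN1r.
Qed.

Lemma gen_sub u g v h : gen s u g -> gen s v h ->
  gen s (fun q => u q - v q) (fun q => g q - h q).
Proof.
by move=> ug vh; apply: gen_eq (gen_comb 1 (-1) ug vh) _ _ => q; rewrite mul1r mulN1r.
Qed.

(** Accretivity applied to [u - J t f]: a stability estimate for approximate solutions, the common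
    source of uniqueness, nonexpansiveness and the error bound for halved steps. *)
Lemma heat_res_contract t f u g (c : R) : step_ok t -> BC f -> gen s u g -> BC u ->
  (forall q, `|u q - t * g q - f q| <= c) -> forall q, `|u q - J t f q| <= c.
Proof.
move=> tok fBC ug uBC H q; have [Jg JBC] := heat_resP tok fBC.
have [t0 tt] := tok; have [_ [N uN]] := BC_sub uBC JBC.
apply: (accretive (gen_sub ug Jg) uN (ltW t0) tt) => x.
rewrite (_ : _ - _ = u x - t * g x - f x) //.
by field; rewrite gt_eqF.
Qed.

Lemma heat_res_uniq t f u g : step_ok t -> BC f -> gen s u g -> BC u ->
  (forall q, u q - t * g q = f q) -> u = J t f.
Proof.
move=> tok fBC ug uBC H; apply/funext => q; apply/eqP.
rewrite -subr_eq0 -normr_le0; apply: (heat_res_contract tok fBC ug uBC) => x.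
by rewrite H subrr normr0.
Qed.

Lemma heat_res_lip t f g (c : R) : step_ok t -> BC f -> BC g ->
  (forall q, `|f q - g q| <= c) -> forall q, `|J t f q - J t g q| <= c.
Proof.
move=> tok fBC gBC H; have [fg JBC] := heat_resP tok fBC.
apply: (heat_res_contract tok gBC fg JBC) => x; have [t0 _] := tok.
by rewrite mulrCA divff ?gt_eqF // mulr1 subKr.
Qed.

Lemma heat_res_bound t f (c : R) : step_ok t -> BC f ->
  (forall q, `|f q| <= c) -> forall q, `|J t f q| <= c.
Proof.
move=> tok fBC fc; have [fg [_ [N JN]]] := heat_resP tok fBC.
have [t0 tt] := tok; apply: (accretive fg JN (ltW t0) tt) => x.
by rewrite mulrCA divff ?gt_eqF // mulr1 subKr.
Qed.

(** [f + t J A f] solves the resolvent equation for [f], hence is [J f] by uniqueness; in particular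
    J and A commute. *)
Lemma heat_res_gen t f g : step_ok t -> BC f -> BC g -> gen s f g ->
  gen s (J t f) (J t g) /\ forall q, J t f q = f q + t * J t g q.
Proof.
move=> tok fBC gBC fg; have [t0 _] := tok.
have [Jg JgBC] := heat_resP tok gBC.
have zg : gen s (fun q => f q + t * J t g q) (J t g).
  apply: gen_eq (gen_comb 1 t fg Jg) _ _ => q; first by rewrite mul1r.
  by field; rewrite gt_eqF.
have zBC : BC (fun q => f q + t * J t g q).
  have := BC_comb 1 t fBC JgBC.
  by under [X in BC X -> _]eq_fun do rewrite mul1r.
have E : (fun q => f q + t * J t g q) = J t f.
  by apply: (heat_res_uniq tok fBC zg zBC) => q; rewrite addrK.
by split; [rewrite -E | move=> q; rewrite -E].
Qed.

(** As (1 - t/2 A)^2 = 1 - t A + t^2/4 A^2, the function obtained by two half steps solves the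
    full-step equation with residual [- t^2/4] times its image under A^2. *)
Lemma heat_res_halve t f0 f1 f2 (c : R) : step_ok t -> BC f0 -> BC f1 -> BC f2 ->
  gen s f0 f1 -> gen s f1 f2 -> (forall q, `|f2 q| <= c) ->
  forall q, `|J t f0 q - J (t / 2) (J (t / 2) f0) q| <= t ^+ 2 / 4 * c.
Proof.
move=> tok b0 b1 b2 g01 g12 f2c q; have [t0 tt] := tok.
have hok : step_ok (t / 2) by rewrite /step_ok; lra.
have [j01 e0] := heat_res_gen hok b0 b1 g01.
have [j12 e1] := heat_res_gen hok b1 b2 g12.
have [_ j0] := heat_resP hok b0.
have [_ j1] := heat_resP hok b1.
have [_ j2] := heat_resP hok b2.
have [k01 e2] := heat_res_gen hok j0 j1 j01.
have [k12 e3] := heat_res_gen hok j1 j2 j12.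
have [_ k0] := heat_resP hok j0.
rewrite distrC; apply: (heat_res_contract tok b0 k01 k0) => x.
have -> : J (t / 2) (J (t / 2) f0) x - t * J (t / 2) (J (t / 2) f1) x - f0 x =
    - (t ^+ 2 / 4 * J (t / 2) (J (t / 2) f2) x).
  by have := e0 x; have := e2 x; have := e3 x; nra.
rewrite normrN normrM ger0_norm ?divr_ge0 ?sqr_ge0 // ler_wpM2l ?divr_ge0 ?sqr_ge0 //.
by do 2 apply: heat_res_bound => //.
Qed.

(** [W m] stands for A^m applied to [W 0]; the orbit is carried as a sequence because A is given
    only as the relation [gen]. *)
Definition chain (W : nat -> R -> R) (N : nat -> R) : Prop := forall m,
  gen s (W m) (W m.+1) /\ forall q, `|W m q| <= N m.

Lemma chain_BC W N m : chain W N -> BC (W m).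
Proof.
by move=> WN; have [g b] := WN m; split; [exact: gen_continuous g | exists (N m)].
Qed.

(** * Implicit Euler scheme with dyadic steps *)

Let tau k : R := tm / 2 ^+ k.

Let tau_ok k : step_ok (tau k).
Proof.
have p : 0 < 2 ^+ k :> R by rewrite exprn_gt0.
split; first by rewrite divr_gt0.
by rewrite /tau ler_pdivrMr // ler_peMr ?exprn_ege1 ?ler1n // ltW.
Qed.

Let tauS k : tau k.+1 = tau k / 2. Proof. by rewrite /tau exprSr invfM mulrA. Qed.

Let E k n f : R -> R := iter n (J (tau k)) f.

Let E_chain k n W N : chain W N -> chain (fun m => E k n (W m)) N.
Proof.
move=> WN; elim: n => [//|n IH] m; have [g b] := IH m; split.
  exact: (heat_res_gen (tau_ok k) (chain_BC m IH) (chain_BC m.+1 IH) g).1.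
exact: (heat_res_bound (tau_ok k) (chain_BC m IH)).
Qed.

(** Full steps are replaced one at a time by pairs of half steps; each replacement costs [tau^2 / 4]
    times the bound on A^2, and nonexpansive resolvents do not amplify earlier errors. *)
Let E_halve k n W N m q : chain W N ->
  `|E k n (W m) q - E k.+1 n.*2 (W m) q| <= n%:R * (tau k ^+ 2 / 4 * N m.+2).
Proof.
move=> WN; elim: n q => [|n IH] q; first by rewrite subrr normr0 mul0r.
have C := E_chain k.+1 n.*2 WN; have C1 := E_chain k n WN.
have [g0 _] := C m; have [g1 _] := C m.+1; have [_ b2] := C m.+2.
apply: le_trans (ler_distD (J (tau k) (E k.+1 n.*2 (W m)) q) _ _) _.
rewrite doubleS -natr1 mulrDl mul1r; apply: lerD.
  exact: (heat_res_lip (tau_ok k) (chain_BC m C1) (chain_BC m C) IH).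
have := heat_res_halve (tau_ok k) (chain_BC m C) (chain_BC m.+1 C)
  (chain_BC m.+2 C) g0 g1 b2 q.
by rewrite -tauS.
Qed.

Let E_step k n W N m q : chain W N ->
  E k n.+1 (W m) q - E k n (W m) q = tau k * E k n.+1 (W m.+1) q.
Proof.
move=> WN; have C := E_chain k n WN.
have [_ e] := heat_res_gen (tau_ok k) (chain_BC m C) (chain_BC m.+1 C) (C m).1.
rewrite -[E k n.+1 (W m)]/(J (tau k) (E k n (W m))) e.
by rewrite addrAC subrr add0r.
Qed.

Let E_taylor1 k l d W N m q : chain W N ->
  `|E k (l + d) (W m) q - E k l (W m) q| <= d%:R * tau k * N m.+1.
Proof.
move=> WN; have t0 := (tau_ok k).1; elim: d => [|d IH].
  by rewrite addn0 subrr normr0 !mul0r.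
rewrite addnS; apply: le_trans (ler_distD (E k (l + d) (W m) q) _ _) _.
rewrite (E_step k (l + d) m q WN) -natr1 -mulrA mulrDl mul1r addrC lerD //; first by rewrite mulrA.
by rewrite normrM gtr0_norm // ler_pM2l //; have [_] := E_chain k (l + d).+1 WN m.+1.
Qed.

(** Discrete second-order Taylor bound. The scheme is implicit, so each increment is [tau k] times A
    at the end of the step: the new error involves [d + 1] steps, and [d^2 + d + 1 <= (d + 1)^2]. *)
Let E_taylor2 k l d W N m q : chain W N ->
  `|E k (l + d) (W m) q - E k l (W m) q - d%:R * tau k * E k l (W m.+1) q|
    <= (d%:R * tau k) ^+ 2 * N m.+2.
Proof.
move=> WN; have t0 := (tau_ok k).1; elim: d => [|d IH].
  by rewrite addn0 subrr !mul0r subrr normr0 expr0n /= mul0r.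
have S := E_step k (l + d) m q WN; rewrite addnS.
have -> : E k (l + d).+1 (W m) q - E k l (W m) q - d.+1%:R * tau k * E k l (W m.+1) q
  = (E k (l + d) (W m) q - E k l (W m) q - d%:R * tau k * E k l (W m.+1) q)
    + tau k * (E k (l + d).+1 (W m.+1) q - E k l (W m.+1) q).
  by rewrite mulrBr -S -natr1; ring.
have T := E_taylor1 k l d.+1 m.+1 q WN; rewrite addnS in T.
apply: le_trans (ler_normD _ _) _; apply: le_trans (lerD IH (lexx _)) _.
rewrite normrM (gtr0_norm t0).
apply: le_trans (lerD (lexx _) (ler_wpM2l (ltW t0) T)) _.
have N0 : 0 <= N m.+2 by apply: le_trans (normr_ge0 _) ((WN m.+2).2 0).
have h1 := mulr_ge0 (sqr_ge0 (tau k)) N0.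
have h2 := mulr_ge0 (ler0n R d) h1.
by rewrite -natr1; lra.
Qed.

Let grid k (t : R) := Num.truncn (t / tau k).

Let grid_itv k (t : R) : 0 <= t ->
  (grid k t)%:R * tau k <= t /\ t < (grid k t)%:R * tau k + tau k.
Proof.
move=> t0; have p := (tau_ok k).1.
have /andP[a b] : (grid k t)%:R <= t / tau k < (grid k t).+1%:R.
  by apply: truncn_itv; rewrite divr_ge0 // ltW.
by rewrite -[X in _ < _ + X]mul1r -mulrDl natr1 -ler_pdivlMr // -ltr_pdivrMr.
Qed.

(** Halving the step doubles the number of completed steps, with possibly one further half step
    before [t]. *)
Let gridS k (t : R) : 0 <= t ->
  grid k.+1 t = (grid k t).*2 \/ grid k.+1 t = (grid k t).*2.+1.
Proof.
move=> t0; have [a b] := grid_itv k t0; have [c d] := grid_itv k.+1 t0.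
have p := (tau_ok k).1; rewrite tauS in c d.
have h1 : (grid k.+1 t < (grid k t).+1.*2)%N.
  rewrite -(ltr_nat R) -(ltr_pM2r p) -muln2 natrM -natr1; lra.
have h2 : ((grid k t).*2 < (grid k.+1 t).+1)%N.
  rewrite -(ltr_nat R) -(ltr_pM2r p) -muln2 natrM -natr1; lra.
rewrite ltnS leq_eqVlt in h2; case/orP: h2 => [/eqP ->|h2]; first by left.
by right; apply/eqP; rewrite eqn_leq h2 andbT; rewrite doubleS ltnS in h1.
Qed.

(** First term: at most [t / tau k] replaced steps, each costing [tau k ^ 2 / 4]. Second term: the
    possible additional half step. *)
Let cauchy_const (N : nat -> R) m (t : R) : R := tm * (t * N m.+2 / 4 + N m.+1 / 2).

Let approx_cauchy k W N m (t : R) q : chain W N -> 0 <= t ->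
  `|E k.+1 (grid k.+1 t) (W m) q - E k (grid k t) (W m) q|
    <= cauchy_const N m t / 2 ^+ k.
Proof.
move=> WN t0; have p := (tau_ok k).1.
have N1 : 0 <= N m.+1 by apply: le_trans (normr_ge0 _) ((WN m.+1).2 0).
have N2 : 0 <= N m.+2 by apply: le_trans (normr_ge0 _) ((WN m.+2).2 0).
have h := E_halve k (grid k t) m q WN; rewrite distrC in h.
have h' : `|E k.+1 (grid k t).*2 (W m) q - E k (grid k t) (W m) q| <=
    tau k * (t * N m.+2 / 4).
  apply: le_trans h _; have [g _] := grid_itv k t0.
  have := ler_wpM2r (mulr_ge0 (ltW p) N2) g; nra.
have -> : cauchy_const N m t / 2 ^+ k = tau k * (N m.+1 / 2) + tau k * (t * N m.+2 / 4).
  by rewrite /cauchy_const /tau; ring.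
apply: le_trans (ler_distD (E k.+1 (grid k t).*2 (W m) q) _ _) _.
apply: lerD => //; case: (gridS k t0) => ->.
  by rewrite subrr normr0 mulr_ge0 ?divr_ge0 // ltW.
have := E_taylor1 k.+1 (grid k t).*2 1 m q WN; rewrite addn1 mul1r tauS.
by rewrite -mulrA [_^-1 * _]mulrC.
Qed.

Lemma le_half_powP (x c C : R) : (forall k, x <= c + C / 2 ^+ k) -> x <= c.
Proof.
move=> H; apply/ler_addgt0Pr => e e0; have [k kP] := small_half_pow C e0.
by apply: le_trans (H k) _; rewrite lerD2l.
Qed.

(* Limit of the implicit Euler scheme (1 - tau A)^{- floor (t / tau)} as
   tau = tm / 2^k tends to 0. *)
Lemma semigroup_exists W N : chain W N -> exists U : nat -> R -> R -> R,
  [/\ forall t, 0 <= t -> chain (fun m => U m t) N,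
      forall m, U m 0 = W m
    & forall m t r q, 0 <= r -> r <= t ->
        `|U m t q - U m r q - (t - r) * U m.+1 r q| <= (t - r) ^+ 2 * N m.+2].
Proof.
move=> WN.
have NP m : 0 <= N m by apply: le_trans (normr_ge0 _) ((WN m).2 0).
pose C m t := 2 * cauchy_const N m t.
(* The limit is taken pointwise in [(m, t, q)], with default 0 at negative times. *)
have /choice [U UP] : forall z : nat * R * R, exists l, 0 <= z.1.2 ->
    forall k, `|l - E k (grid k z.1.2) (W z.1.1) z.2| <= C z.1.1 z.1.2 / 2 ^+ k.
  move=> [[m t] q] /=; have [t0|t0] := leP 0 t; last by exists 0.
  have [l lP] := geometric_cauchy (fun k => approx_cauchy k m q WN t0).
  by exists l => _ k; exact: lP.
have {}UP m t q k : 0 <= t -> `|U (m, t, q) - E k (grid k t) (W m) q| <= C m t / 2 ^+ k.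
  by move=> t0; exact: (UP (m, t, q)).
pose V m t q := U (m, t, q).
have bd m t q : 0 <= t -> `|V m t q| <= N m.
  move=> t0; apply: (@le_half_powP _ _ (C m t)) => k.
  have [_ /(_ q) b] := E_chain k (grid k t) WN m.
  rewrite -(subrK (E k (grid k t) (W m) q) (V m t q)) [leRHS]addrC.
  exact: le_trans (ler_normD _ _) (lerD (UP m t q k t0) b).
have VBC m t : 0 <= t -> BC (V m t).
  move=> t0; split; last by exists (N m) => q; exact: bd.
  apply: (uniform_limit_continuous (u := fun k => E k (grid k t) (W m))) => [k|k q].
    exact: gen_continuous (E_chain k (grid k t) WN m).1.
  exact: UP.
have tok : step_ok tm by [].
exists V; split=> [t t0 m|m|m t r q r0 rt].
- split=> [|q]; last exact: bd.
  (* Closedness of A: the approximations [w] solve the resolvent equation for data tending uniformly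
     to [f], so by stability their limit [V m t] is [J tm f], which lies in the domain. *)
  pose f q := V m t q - tm * V m.+1 t q.
  have fBC : BC f.
    have := BC_comb 1 (- tm) (VBC m t t0) (VBC m.+1 t t0).
    by under [X in BC X -> _]eq_fun do rewrite mul1r mulNr.
  have [gJ JBC] := heat_resP tok fBC.
  have JV : J tm f = V m t.
    apply/funext => q; apply/eqP; rewrite -subr_eq0 -normr_le0.
    apply: (@le_half_powP _ _ (2 * C m t + tm * C m.+1 t)) => k; rewrite add0r.
    pose w i := E k (grid k t) (W i).
    have wC : chain w N := E_chain k (grid k t) WN.
    have wm x := UP m t x k t0; have wm1 x := UP m.+1 t x k t0.
    have h : `|w m q - J tm f q| <= (C m t + tm * C m.+1 t) / 2 ^+ k.
      apply: (heat_res_contract tok fBC (wC m).1 (chain_BC m wC)) => x.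
      rewrite (_ : _ - f x = - (V m t x - w m x) + tm * (V m.+1 t x - w m.+1 x)).
        apply: le_trans (ler_normD _ _) _; rewrite normrN normrM gtr0_norm //.
        rewrite mulrDl -[tm * C _ _ / _]mulrA; apply: lerD; first exact: wm.
        by rewrite ler_pM2l //; exact: wm1.
      by rewrite /f; ring.
    have := ler_distD (w m q) (J tm f q) (V m t q).
    rewrite [`|J tm f q - w m q|]distrC [`|w m q - V m t q|]distrC.
    have := wm q; rewrite -/(w m) -/(V m t q); lra.
  apply: gen_eq gJ _ _ => q; first by rewrite JV.
  by rewrite JV /f opprB addrC subrK mulrC mulKf // gt_eqF.
- apply/funext => q; apply/eqP; rewrite -subr_eq0 -normr_le0.
  apply: (@le_half_powP _ _ (C m 0)) => k; rewrite add0r.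
  have := UP m 0 q k (lexx 0).
  by rewrite /grid mul0r truncn0.
- have t0 : 0 <= t by exact: le_trans rt.
  pose D := t - r; have D0 : 0 <= D by rewrite subr_ge0.
  (* The constant collects the errors of order [2^-k]: the three approximated values, the gap
     between [D = t - r] and the grid distance [d], and the resulting excess of [d^2] over [D^2]. *)
  apply: (@le_half_powP _ _ (C m t + C m r + (D + tm) * C m.+1 r
     + tm * N m.+1 + tm * (2 * D + tm) * N m.+2)) => k.
  have p := (tau_ok k).1; have ptm := (tau_ok k).2.
  have [a1 a2] := grid_itv k t0; have [b1 b2] := grid_itv k r0.
  have lr : (grid k r <= grid k t)%N.
    have : (grid k r < (grid k t).+1)%N.
      by rewrite -(ltr_nat R) -(ltr_pM2r p) -natr1; lra.
    by rewrite ltnS.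
  have T := E_taylor2 k (grid k r) (grid k t - grid k r) m q WN.
  rewrite subnKC // natrB // in T.
  set d := (_ - _) * tau k in T.
  have d1 : d <= D + tau k by rewrite /d /D mulrBl; lra.
  have d2 : D - tau k <= d by rewrite /d /D mulrBl; lra.
  have d0 : 0 <= d by rewrite /d mulr_ge0 ?(ltW p) // subr_ge0 ler_nat.
  have h1 := UP m t q k t0; have h2 := UP m r q k r0.
  have h3 := UP m.+1 r q k r0.
  set e1 := E k (grid k t) (W m) q in T h1 *.
  set e2 := E k (grid k r) (W m) q in T h2 *.
  set e3 := E k (grid k r) (W m.+1) q in T h3 *.
  rewrite -/(V m t q) in h1; rewrite -/(V m r q) in h2; rewrite -/(V m.+1 r q) in h3.
  have v3 := bd m.+1 r q r0.
  have -> : V m t q - V m r q - D * V m.+1 r q =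
     (V m t q - e1) - (V m r q - e2) + (e1 - e2 - d * e3) - d * (V m.+1 r q - e3)
     - (D - d) * V m.+1 r q by ring.
  apply: le_trans (ler_normB _ _) _; rewrite normrM.
  have q1 : `|D - d| * `|V m.+1 r q| <= tau k * N m.+1.
    by apply: ler_pM => //; rewrite ler_norml; apply/andP; split; lra.
  apply: le_trans (lerD (ler_normB _ _) q1) _; rewrite normrM (ger0_norm d0).
  have q2 : d * `|V m.+1 r q - e3| <= (D + tm) * (C m.+1 r / 2 ^+ k).
    by apply: ler_pM => //; lra.
  apply: le_trans (lerD (lerD (ler_normD _ _) q2) (lexx _)) _.
  apply: le_trans (lerD (lerD (lerD (ler_normB _ _) T) (lexx _)) (lexx _)) _.
  have q3 : d ^+ 2 * N m.+2 <= (D ^+ 2 + tau k * (2 * D + tm)) * N m.+2.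
    rewrite ler_wpM2r //; apply: le_trans (_ : (D + tau k) ^+ 2 <= _).
      by rewrite ler_sqr // nnegrE; lra.
    have := ler_wpM2l (ltW p) ptm; rewrite !expr2; lra.
  have -> : (C m t + C m r + (D + tm) * C m.+1 r + tm * N m.+1 +
     tm * (2 * D + tm) * N m.+2) / 2 ^+ k = C m t / 2 ^+ k + C m r / 2 ^+ k
     + (D + tm) * (C m.+1 r / 2 ^+ k) + tau k * N m.+1 + tau k * (2 * D + tm) * N m.+2.
    by rewrite /tau; ring.
  by rewrite -/D; lra.
Qed.

End Semigroup.

(** * Weighted derivative estimates *)

Section Symbols.
Context {R : realType}.
Variable s : R -> R.
Hypothesis s_gt0 : forall q, 0 < s q.
Implicit Types (f g u v : R -> R) (q : R) (n : nat) (d e : int).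

(* |f^(i)| <= C s^(d - i) for all i <= n. *)
Fixpoint symb n d (C : R) f : Prop :=
  (forall q, `|f q| <= C * s q ^ d) /\
  if n is n'.+1 then exists2 f', has_derivative f f' & symb n' (d - 1) C f'
  else True.

Let sz_gt0 d q : 0 < s q ^ d. Proof. by rewrite exprz_gt0. Qed.

Lemma symb_bound n d C f : symb n d C f -> forall q, `|f q| <= C * s q ^ d.
Proof. by case: n => [|n] []. Qed.

Lemma symb_ge0 n d C f : symb n d C f -> 0 <= C.
Proof.
move=> /symb_bound /(_ 0) H; rewrite -(pmulr_lge0 _ (sz_gt0 d 0)).
exact: le_trans H.
Qed.

Lemma symbW n d C D f : C <= D -> symb n d C f -> symb n d D f.
Proof.
move=> CD; elim: n d f => [|n IH] d f [b H]; split=> //.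
- by move=> q; apply: le_trans (b q) _; rewrite ler_pM2r.
- by move=> q; apply: le_trans (b q) _; rewrite ler_pM2r.
- by case: H => f' df /IH; exists f'.
Qed.

Lemma symb_pred n d C f : symb n.+1 d C f -> symb n d C f.
Proof.
elim: n d f => [|n IH] d f [b [f' df H]]; split=> //.
by exists f' => //; exact: IH.
Qed.

Lemma symbD n d C D f g : symb n d C f -> symb n d D g ->
  symb n d (C + D) (fun q => f q + g q).
Proof.
elim: n d f g => [|n IH] d f g [bf Hf] [bg Hg]; split=> //.
- by move=> q; rewrite mulrDl; apply: le_trans (ler_normD _ _) (lerD (bf q) (bg q)).
- by move=> q; rewrite mulrDl; apply: le_trans (ler_normD _ _) (lerD (bf q) (bg q)).
- case: Hf Hg => f' df Hf [g' dg Hg]; exists (fun q => f' q + g' q).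
    exact: has_derivativeD.
  exact: IH.
Qed.

Lemma symbM n d e C D f g : symb n d C f -> symb n e D g ->
  symb n (d + e) (2 ^+ n * (C * D)) (fun q => f q * g q).
Proof.
have b m (d1 e1 : int) f1 g1 q : symb m d1 C f1 -> symb m e1 D g1 ->
    `|f1 q * g1 q| <= C * D * s q ^ (d1 + e1).
  move=> /symb_bound bf /symb_bound bg.
  by rewrite expfzDr ?gt_eqF // mulrACA normrM ler_pM.
elim: n d e f g => [|n IH] d e f g Sf Sg.
  by split=> // q; rewrite expr0 mul1r; apply: (b 0%N).
have CD0 : 0 <= C * D by rewrite mulr_ge0 ?(symb_ge0 Sf) ?(symb_ge0 Sg).
split=> [q|].
  apply: le_trans (b _ _ _ _ _ q Sf Sg) _; rewrite ler_pM2r // ler_peMl //.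
  by rewrite exprn_ege1 // ler1n.
have Sf0 := symb_pred Sf; have Sg0 := symb_pred Sg.
case: Sf Sg => _ [f' df Sf] [_ [g' dg Sg]].
exists (fun q => f' q * g q + f q * g' q); first exact: has_derivativeM.
have -> : 2 ^+ n.+1 * (C * D) = 2 ^+ n * (C * D) + 2 ^+ n * (C * D).
  by rewrite exprS; ring.
apply: symbD.
  by have := IH _ _ _ _ Sf Sg0; rewrite addrAC.
by have := IH _ _ _ _ Sf0 Sg; rewrite addrA.
Qed.

Lemma symb0 n d : symb n d 0 (fun=> 0).
Proof.
elim: n d => [|n IH] d; split=> //; try by move=> q; rewrite normr0 mul0r.
by exists (fun=> 0) => //; exact: has_derivative_cst.
Qed.

Lemma symb_cst n (a : R) : symb n 0 `|a| (fun=> a).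
Proof.
case: n => [|n]; split=> //; try by move=> q; rewrite expr0z mulr1.
exists (fun=> 0); first exact: has_derivative_cst.
exact: symbW (symb0 _ _).
Qed.

(** Analogue of a symbol class of order [d]: every derivative gains a factor [1 / s]. *)
Definition symbol d f : Prop := forall n, exists C, symb n d C f.

Lemma symbol_mul d e f g : symbol d f -> symbol e g -> symbol (d + e) (fun q => f q * g q).
Proof.
move=> Sf Sg n; have [C HC] := Sf n; have [D HD] := Sg n.
by exists (2 ^+ n * (C * D)); exact: symbM.
Qed.

Lemma symbol_cst (a : R) : symbol 0 (fun=> a).
Proof. by move=> n; exists `|a|; exact: symb_cst. Qed.

Lemma symbol_derive d f : symbol d f ->
  exists2 f', has_derivative f f' & symbol (d - 1) f'.
Proof.
move=> Sf; have [C [_ [f' df _]]] := Sf 1%N; exists f' => // n.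
have [D [_ [g dg Hg]]] := Sf n.+1; exists D.
by rewrite (has_derivative_uniq df dg).
Qed.

(** Induction on the number of controlled derivatives through (1/s)' = - s' (1/s)^2, where [s'] has
    order 0. *)
Lemma symbol_inv : symbol 1 s -> symbol (-1) (fun q => (s q)^-1).
Proof.
move=> Ss; have [s' ds Ss'] := symbol_derive Ss.
have b q : `|(s q)^-1| <= 1 * s q ^ (-1 : int).
  by rewrite mul1r normfV gtr0_norm // exprN1.
elim=> [|n [C IH]]; first by exists 1; split.
have [D HD] := Ss' n.
have H := symbM (symbM HD IH) (symbM IH (symb_cst n (-1))).
set K := (X in symb _ _ X _) in H.
have K0 := symb_ge0 H.
exists (1 + K); split=> [q|].
  apply: le_trans (b q) _; rewrite ler_pM2r //; lra.
exists (fun q => s' q * (s q)^-1 * ((s q)^-1 * -1)); last first.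
  apply: symbW (_ : symb n _ K _); first by rewrite lerDr.
  exact: H.
have sn q : s q != 0 by rewrite gt_eqF.
by apply: has_derivative_eq (has_derivativeV sn ds) _ _ => // q; field.
Qed.

Lemma symb_derive1n n d C f i : symb n d C f -> (i <= n)%N ->
  (forall q, `|derive1n i f q| <= C * s q ^ (d - i%:Z)) /\
  ((i < n)%N -> forall q, is_derive q (1 : R) (derive1n i f) (derive1n i.+1 f q)).
Proof.
have D g g' : has_derivative g g' -> derive1 g = g'.
  by move=> dg; apply/funext => q; rewrite derive1E; have dq := dg q; exact: derive_val.
elim: n d f i => [|n IH] d f [|i] // H.
- by move=> _; split=> //; rewrite subr0; exact: symb_bound H.
- move=> _; split=> [|_ q]; first by rewrite subr0; exact: symb_bound H.
  by case: H => _ [f' df _]; rewrite derive1n1 (D _ _ df); exact: df.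
- case: H => _ [f' df H]; rewrite ltnS => ni.
  rewrite !(derive1Sn f) (D _ _ df).
  have [b1 b2] := IH _ _ i H ni; split=> [q|]; last by [].
  by apply: le_trans (b1 q) _; rewrite -addrA -opprD -intS.
Qed.

Lemma symbol_of_derive1n d f : smooth1 f ->
  (forall i, exists C, forall q, `|derive1n i f q| <= C * s q ^ (d - i%:Z)) ->
  symbol d f.
Proof.
move=> sf bf n; elim: n d f sf bf => [|n IH] d f sf bf.
  by have [C HC] := bf 0%N; exists C; split=> // q; have := HC q; rewrite subr0.
have [C0 HC0] := bf 0%N.
have [||C HC] := IH (d - 1) (derive1 f).
- by move=> i x; rewrite -derive1Sn; exact: sf.
- move=> i; have [C HC] := bf i.+1; exists C => q.
  by rewrite -derive1Sn; apply: le_trans (HC q) _; rewrite -addrA -opprD -intS.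
have C00 : 0 <= C0.
  rewrite -(pmulr_lge0 _ (sz_gt0 (d - 0) 0)); exact: le_trans (HC0 0).
exists (C0 + C); split=> [q|].
  have := HC0 q; rewrite subr0 => h; apply: le_trans h _.
  by rewrite ler_pM2r // lerDl (symb_ge0 HC).
exists (derive1 f).
  by move=> x; rewrite derive1E; apply: derivableP; exact: (sf 0%N).
by apply: symbW HC; rewrite lerDr.
Qed.

(** A preserves order 0: [s^2] has order 2 and the second derivative of [f] has order -2. Hence
    every A^m f is bounded. *)
Lemma symbol_gen f : symbol 1 s -> symbol 0 f ->
  exists2 g, gen s f g & symbol 0 g.
Proof.
move=> Ss Sf; have [f1 df1 Sf1] := symbol_derive Sf.
have [f2 df2 Sf2] := symbol_derive Sf1.
exists (fun q => 2^-1 * (s q * s q) * f2 q); last first.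
  exact: (symbol_mul (symbol_mul (symbol_cst 2^-1) (symbol_mul Ss Ss)) Sf2).
exists f1 => //; apply: has_derivative_eq df2 _ _ => // q.
by field; rewrite gt_eqF.
Qed.

Lemma symbol_chain f : symbol 1 s -> symbol 0 f ->
  exists W N, W 0%N = f /\ chain s W N.
Proof.
move=> Ss Sf.
have /choice [A AP] : forall f, exists g, symbol 0 f -> gen s f g /\ symbol 0 g.
  move=> h; have [Sh|nh] := pselect (symbol 0 h); last by exists h.
  by have [g] := symbol_gen Ss Sh; exists g.
have SW m : symbol 0 (iter m A f) by elim: m => [//|m IH]; exact: (AP _ IH).2.
have /choice [N NP] : forall m, exists C, symb 0 0 C (iter m A f).
  by move=> m; exact: SW.
exists (fun m => iter m A f), N; split=> // m; split; first exact: (AP _ (SW m)).1.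
by move=> q; have [/(_ q)] := NP m; rewrite expr0z mulr1.
Qed.

(** On the interval of length [l = s q / (2 L)] after [q], [s] stays above [s q / 2]. The mean slope
    of [u] there is at most [2 N / l], and [p] varies by at most [l] times the bound on u'' = 2 g /
    s^2. *)
Lemma gen_interpolation (L N : R) s' u g p : 0 < L -> has_derivative s s' ->
  (forall q, `|s' q| <= L) -> has_derivative u p ->
  has_derivative p (fun q => 2 * g q / s q ^+ 2) ->
  (forall q, `|u q| <= N) -> (forall q, `|g q| <= N) ->
  forall q, `|p q| <= (4 * L + 4 / L) * N * s q ^ (-1 : int).
Proof.
move=> L0 ds s'L du dp uN gN q.
have sq := s_gt0 q; rewrite exprN1.
have N0 : 0 <= N by apply: le_trans (uN 0).
pose l := s q / (2 * L); have l0 : 0 < l by rewrite divr_gt0 // mulr_gt0.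
have [c] := mean_value q (q + l) du; rewrite [q + l]addrC addrK (gtr0_norm l0) => cl Ec.
have [c2] := mean_value q c dp => c2c Ec2.
have c2l := le_trans c2c cl.
have s2 : s q / 2 <= s c2.
  have [c3 _ Ec3] := mean_value q c2 ds.
  have : `|s c2 - s q| <= L * l by rewrite Ec3 normrM ler_pM.
  have -> : L * l = s q / 2 by rewrite /l; field; rewrite gt_eqF.
  by rewrite ler_norml => /andP[]; lra.
have pc : `|p c| <= 2 * N / l.
  have -> : p c = (u (l + q) - u q) / l by rewrite Ec mulfK ?gt_eqF.
  rewrite normrM normfV (gtr0_norm l0) ler_pM2r ?invr_gt0 //.
  by apply: le_trans (ler_normB _ _) _; have := uN (l + q); have := uN q; lra.
have pp : `|2 * g c2 / s c2 ^+ 2| <= 8 * N / s q ^+ 2.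
  rewrite !normrM normfV normrX (gtr0_norm (s_gt0 _)) gtr0_norm //.
  have -> : 8 * N / s q ^+ 2 = 2 * N * ((s q / 2) ^+ 2)^-1.
    by field; rewrite gt_eqF.
  apply: ler_pM; rewrite ?invr_ge0 ?sqr_ge0 ?mulr_ge0 //.
    by rewrite ler_pM2l.
  rewrite lef_pV2 ?posrE ?exprn_gt0 ?divr_gt0 //.
  by rewrite ler_sqr // nnegrE ltW // divr_gt0.
have pd : `|p c - p q| <= 8 * N / s q ^+ 2 * l by rewrite Ec2 normrM ler_pM.
have -> : (4 * L + 4 / L) * N / s q = 2 * N / l + 8 * N / s q ^+ 2 * l.
  by rewrite /l; field; rewrite !gt_eqF.
rewrite -(subKr (p c) (p q)); apply: le_trans (ler_normB _ _) (lerD pc pd).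
Qed.

Lemma symbol_lipschitz : symbol 1 s -> exists s' L, [/\ has_derivative s s',
  symbol 0 s', 0 < L & forall q, `|s' q| <= L].
Proof.
move=> Ss; have [s' ds Ss'] := symbol_derive Ss; rewrite subrr in Ss'.
have [C [HC _]] := Ss' 0%N; exists s', (`|C| + 1); split; [exact: ds|exact: Ss'|by rewrite ltr_wpDl|].
move=> q; apply: le_trans (HC q) _; rewrite expr0z mulr1.
by apply: le_trans (ler_norm C) _; rewrite lerDl.
Qed.

(* The weighted derivatives of u are controlled by u, A u, ..., A^n u alone,
   since u'' = 2 s^-2 A u and u' is interpolated between u and A u. *)
Lemma chain_regularity : symbol 1 s -> forall n, exists2 K, 0 <= K &
  forall W (N : R), (forall m, gen s (W m) (W m.+1)) ->
    (forall m q, (m <= n)%N -> `|W m q| <= N) -> symb n 0 (K * N) (W 0%N).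
Proof.
move=> Ss n; have [s' [L [ds _ L0 s'L]]] := symbol_lipschitz Ss.
pose K1 := 4 * L + 4 / L; have K10 : 0 <= K1.
  by have l0 := ltW L0; rewrite addr_ge0 ?mulr_ge0 ?invr_ge0.
have base (K : R) W (N : R) : 1 <= K -> (forall q, `|W q| <= N) ->
    forall q, `|W q| <= K * N * s q ^ (0 : int).
  move=> K1' WN q; rewrite expr0z mulr1; apply: le_trans (WN q) _.
  by rewrite ler_peMl // (le_trans _ (WN q)).
(* Since u'' is expressed through A u, order [n] for A u gives order [n + 2] for u; the induction
   therefore carries two consecutive orders. *)
suff : forall n, (exists2 K, 0 <= K & forall W (N : R),
    (forall m, gen s (W m) (W m.+1)) ->
    (forall m q, (m <= n)%N -> `|W m q| <= N) -> symb n 0 (K * N) (W 0%N)) /\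
  (exists2 K, 0 <= K & forall W (N : R), (forall m, gen s (W m) (W m.+1)) ->
    (forall m q, (m <= n.+1)%N -> `|W m q| <= N) -> symb n.+1 0 (K * N) (W 0%N)).
  by move=> /(_ n) [].
elim=> [|{}n [[K K0 IH] IH']].
  split; first by exists 1 => // W N _ WN; split=> //; apply: base => // q; exact: WN.
  exists (1 + K1) => [|W N gW WN]; first by rewrite addr_ge0.
  have N0 : 0 <= N by apply: le_trans (WN 0%N 0 _).
  split; first by apply: base => [|q]; [rewrite lerDl | exact: WN].
  have [p du dp] := gW 0%N; exists p => //; split=> // q.
  rewrite sub0r; apply: le_trans (gen_interpolation L0 ds s'L du dp _ _ q) _.
  - by move=> x; exact: WN.
  - by move=> x; exact: WN.
  by rewrite ler_pM2r // ler_wpM2r // lerDr.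
split=> //.
have [C HC] := symbol_mul (symbol_cst 2) (symbol_mul (symbol_inv Ss) (symbol_inv Ss)) n.
have C0 := symb_ge0 HC.
have K20 : 0 <= 2 ^+ n * (C * K) by rewrite mulr_ge0 ?exprn_ge0 // mulr_ge0.
exists (1 + K1 + 2 ^+ n * (C * K)) => [|W N gW WN]; first by rewrite addr_ge0 // addr_ge0.
have N0 : 0 <= N by apply: le_trans (WN 0%N 0 _).
split; first by apply: base => [|q]; [lra | exact: WN].
have [p du dp] := gW 0%N; exists p => //; split=> [q|].
  rewrite sub0r; apply: le_trans (gen_interpolation L0 ds s'L du dp _ _ q) _.
  - by move=> x; exact: WN.
  - by move=> x; exact: WN.
  by rewrite ler_pM2r // ler_wpM2r // -/K1; lra.
have S1 := IH (fun m => W m.+1) N (fun m => gW m.+1) (fun m q mn => WN m.+1 q (leqW mn)).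
exists (fun q => 2 * ((s q)^-1 * (s q)^-1) * W 1%N q).
  by apply: has_derivative_eq dp _ _ => // q; field; rewrite gt_eqF.
have := symbM HC S1; rewrite !add0r addr0 => H.
apply: symbW H; rewrite (_ : 2 ^+ n * _ = 2 ^+ n * (C * K) * N); last by ring.
by rewrite ler_wpM2r // lerDr addr_ge0.
Qed.

End Symbols.

(** * The coefficients *)

Section Coefficients.
Context {R : realType}.
Variables (gamma : R) (sigma sigma0 sigmab : R -> R).
Hypothesis hsigma : diffusion_coefficient gamma sigma sigma0 sigmab.
Implicit Types q : R.

Lemma smooth1_continuous (f : R -> R) i : smooth1 f -> continuous (derive1n i f).
Proof. by move=> sf x; apply/differentiable_continuous/derivable1_diffP/sf. Qed.

Lemma smooth1_continuous0 (f : R -> R) : smooth1 f -> continuous f.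
Proof. by move=> sf x; apply/differentiable_continuous/derivable1_diffP/(sf 0%N). Qed.

Lemma bounded_funP (f : R -> R) : bounded_fun f -> exists M, forall q, `|f q| <= M.
Proof.
by move=> [M0 [_ HM]]; exists (M0 + 1) => q; apply: HM => //; rewrite ltrDl.
Qed.

(** The power laws hold only for [|q| >= 1]; compactness settles the remaining interval. *)
Lemma continuous_unit_bound (f : R -> R) : continuous f ->
  exists M, forall q, `|q| <= 1 -> `|f q| <= M.
Proof.
move=> cf; have cn : {within `[-1, 1], continuous (fun q => `|f q|)}.
  by apply: continuous_subspaceT => x; apply: (cvg_comp _ _ (cf x)); exact: norm_continuous.
have [|c _ cP] := EVT_max _ cn; first by lra.
by exists `|f c| => q q1; apply: cP; rewrite in_itv /= -ler_norml.
Qed.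

Let s_gt0 := sigma_gt0 hsigma.

Lemma sigma_comparable : exists dm dp : R, [/\ 0 < dm, 0 < dp &
  forall q, 1 <= `|q| ->
    dm * `|q| `^ (gamma / 2) <= sigma q <= dp * `|q| `^ (gamma / 2)].
Proof.
have [dm [dp [dm0 dp0 H]]] := sigmab_bounds hsigma.
exists dm, dp; split=> // q q1; rewrite (sigma_factor hsigma) (sigma0_power hsigma) //.
by rewrite [_ * sigmab q]mulrC !ler_wpM2r ?powR_ge0 //; have /andP[] := H q.
Qed.

(** For [|q| >= 1] the product of the derivative of order [i + 1] and [sigma^i] is bounded by a
    multiple of [|q|] to the power [(i + 1) (gamma / 2 - 1)], which is nonpositive since
    [gamma <= 1/2]. *)
Lemma symbol_sigma : symbol sigma 1 sigma.
Proof.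
apply: symbol_of_derive1n; [exact: s_gt0 | exact: sigma_smooth hsigma | case=> [|i]].
  by exists 1 => q; rewrite subr0 expr1z mul1r gtr0_norm.
have [S S0 SP] := sigma_derivative_decay hsigma (ltn0Sn i).
have [dm [dp [dm0 dp0 cmp]]] := sigma_comparable.
have cf : continuous (fun q => derive1n i.+1 sigma q * sigma q ^+ i).
  apply: continuous_mulf; first exact: smooth1_continuous (sigma_smooth hsigma).
  by apply: continuous_expf; exact: (smooth1_continuous0 (sigma_smooth hsigma)).
have [M MP] := continuous_unit_bound cf.
exists (`|M| + S * dp ^+ i) => q.
have si : 0 < sigma q ^+ i by rewrite exprn_gt0.
have -> : sigma q ^ ((1 : int) - i.+1%:Z) = (sigma q ^+ i)^-1.
  by rewrite intS opprD addrA subrr add0r -exprnN.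
rewrite ler_pdivlMr //.
have Sp : 0 <= S * dp ^+ i by rewrite mulr_ge0 ?exprn_ge0 // ltW.
have [q1|q1] := leP `|q| 1.
  have := MP q q1; rewrite normrM [`|_ ^+ i|]gtr0_norm // => h.
  apply: le_trans h _; apply: le_trans (ler_norm M) _; by rewrite lerDl.
have {}q1 := ltW q1; have q0 : 0 < `|q| by exact: lt_le_trans q1.
have /andP[_ h2] := cmp q q1.
apply: le_trans (_ : S * dp ^+ i <= _); last by rewrite lerDr.
apply: le_trans (_ : S * `|q| `^ (gamma / 2 - i.+1%:R) *
  (dp * `|q| `^ (gamma / 2)) ^+ i <= _).
  apply: ler_pM => //; [exact: ltW| exact: SP |].
  by apply: lerXn2r => //; rewrite nnegrE ?mulr_ge0 ?powR_ge0 // ltW.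
rewrite exprMn -[(_ `^ _) ^+ i]powR_mulrn ?powR_ge0 // -powRrM.
have -> : S * `|q| `^ (gamma / 2 - i.+1%:R) * (dp ^+ i * `|q| `^ (gamma / 2 * i%:R)) =
  S * dp ^+ i * (`|q| `^ (gamma / 2 - i.+1%:R) * `|q| `^ (gamma / 2 * i%:R)) by ring.
rewrite -powRD ?(gt_eqF q0) ?implybT // ler_piMr //.
apply: le_trans (_ : `|q| `^ 0 <= 1); last by rewrite powRr0.
rewrite ler_powR //.
have g0 := gamma_ge0 hsigma; have i0 : 0 <= i%:R :> R by [].
have := gamma_le_half hsigma; rewrite -subr_ge0 => gh.
by have := mulr_ge0 i0 gh; rewrite -[i.+1%:R]natr1; lra.
Qed.

(** The upper bound on [sigmab] turns the weight [sigma0] of the hypothesis into the weight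
    [sigma]. *)
Lemma symbol_initial (C0 : R -> R) : initial_condition sigma0 C0 -> symbol sigma 0 C0.
Proof.
move=> hC; apply: symbol_of_derive1n; [exact: s_gt0 | exact: initial_smooth hC | case=> [|i]].
  have [M HM] := bounded_funP (initial_bounded hC).
  by exists M => q; rewrite subr0 expr0z mulr1.
have [B B0 BP] := initial_weighted_derivatives hC (ltn0Sn i).
have [dm [dp [dm0 dp0 H]]] := sigmab_bounds hsigma.
exists (B * dp ^+ i.+1) => q.
have -> : sigma q ^ ((0 : int) - i.+1%:Z) = (sigma q ^+ i.+1)^-1.
  by rewrite sub0r -exprnN.
rewrite ler_pdivlMr ?exprn_gt0 //.
have -> : sigma q ^+ i.+1 = `|sigma0 q ^+ i.+1| * `|sigmab q ^+ i.+1|.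
  by rewrite -normrM -exprMn -(sigma_factor hsigma) ger0_norm ?exprn_ge0 ?ltW.
have /andP[b1 b2] := H q.
rewrite mulrA -normrM; apply: ler_pM => //.
by rewrite normrX ger0_norm ?lerXn2r ?nnegrE //; lra.
Qed.

(** For [|q| >= 1], [sigma] dominates a multiple of [|q|] to the power [gamma / 2]; for [|q| <= 1]
    the right-hand power is at least 1. The origin is set apart for [gamma > 0] because 0 to a
    negative power is 0 by convention, not infinity. *)
Lemma sigma_weight_bound n : exists2 M, 0 <= M &
  forall q, q != 0 \/ gamma = 0 ->
    sigma q ^ ((0 : int) - n%:Z) <= M * `|q| `^ (- (n%:R * gamma / 2)).
Proof.
have [dm [dp [dm0 dp0 cmp]]] := sigma_comparable.
have cf : continuous (fun q => (sigma q ^+ n)^-1).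
  apply: continuous_invf => [q|]; first by rewrite expf_neq0 // gt_eqF.
  by apply: continuous_expf; exact: (smooth1_continuous0 (sigma_smooth hsigma)).
have [M MP] := continuous_unit_bound cf.
have dn : 0 < (dm ^+ n)^-1 by rewrite invr_gt0 exprn_gt0.
exists (`|M| + (dm ^+ n)^-1) => [|q hq]; first by rewrite addr_ge0 // ltW.
have -> : sigma q ^ ((0 : int) - n%:Z) = (sigma q ^+ n)^-1.
  by rewrite sub0r -exprnN.
have [q1|q1] := leP `|q| 1.
  have h1 : 1 <= `|q| `^ (- (n%:R * gamma / 2)).
    case: hq => [q0|->]; last by rewrite mulr0 mul0r oppr0 powRr0.
    rewrite -[leLHS](powRr0 `|q|); apply: ger_powR; first by rewrite normr_gt0 q0.
    by rewrite oppr_le0 divr_ge0 // mulr_ge0 // (gamma_ge0 hsigma).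
  have := MP q q1; rewrite gtr0_norm ?invr_gt0 ?exprn_gt0 // => h.
  apply: le_trans h _; apply: le_trans (ler_norm M) _.
  apply: le_trans (_ : `|M| + (dm ^+ n)^-1 <= _); first by rewrite lerDl ltW.
  by rewrite ler_peMr // addr_ge0 // ltW.
have {}q1 := ltW q1; have q0 : 0 < `|q| by exact: lt_le_trans q1.
have /andP[h _] := cmp q q1.
have p0 : 0 < `|q| `^ (gamma / 2) by rewrite powR_gt0.
apply: le_trans (_ : (dm ^+ n)^-1 * `|q| `^ (- (n%:R * gamma / 2)) <= _); last first.
  by rewrite ler_wpM2r ?powR_ge0 // lerDr.
have -> : n%:R * gamma / 2 = gamma / 2 * n%:R by ring.
rewrite powRN powRrM powR_mulrn ?powR_ge0 // -invfM -exprMn.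
rewrite lef_pV2 ?posrE ?exprn_gt0 ?mulr_gt0 //.
by rewrite lerXn2r // nnegrE ltW // mulr_gt0.
Qed.

End Coefficients.

(** * Regularity in time and space *)

Section TimeRegularity.
Context {R : realType}.
Implicit Types (F G : R -> R -> R) (t r q h : R).

Lemma time_increments_proper t : 0 <= t -> ProperFilter (time_increments t).
Proof.
move=> t0; rewrite /time_increments; apply: Build_ProperFilter_ex.
move=> P; rewrite /within /= near_withinE => /nbhs_ballP [d /= d0 dP].
exists (d / 2); apply: dP; rewrite ?gt_eqF ?divr_gt0 //.
- by rewrite /ball /= sub0r normrN gtr0_norm ?divr_gt0 //; lra.
- by rewrite addr_ge0 // divr_ge0 // ltW.
Qed.

Lemma cvg_time_quotient F G t q (K : R) : 0 <= t ->
  (forall h, `|h| <= 1 -> 0 <= t + h ->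
     `|F (t + h) q - F t q - h * G t q| <= K * h ^+ 2) ->
  time_quotient F t q @ time_increments t --> G t q.
Proof.
move=> t0 H; apply/cvgrPdist_le => e e0.
rewrite /time_increments !near_withinE; apply/nbhs_ballP.
exists (Num.min 1 (e / (`|K| + 1))) => /=.
  by rewrite lt_min ltr01 divr_gt0 // ltr_wpDl.
move=> h; rewrite /ball /= sub0r normrN lt_min => /andP[h1 h2] h0 th.
have hp : 0 < `|h| by rewrite normr_gt0.
have -> : G t q - time_quotient F t q h =
    - (h^-1 * (F (t + h) q - F t q - h * G t q)).
  by rewrite /time_quotient; field.
rewrite normrN normrM normfV mulrC ler_pdivrMr //.
apply: le_trans (H h (ltW h1) th) _.
have -> : h ^+ 2 = `|h| * `|h| by rewrite -expr2 real_normK ?num_real.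
rewrite mulrA ler_pM2r //.
apply: le_trans (_ : (`|K| + 1) * `|h| <= _).
  by rewrite ler_pM2r //; have := ler_norm K; lra.
by rewrite mulrC -ler_pdivlMr ?ltr_wpDl // ltW.
Qed.

Lemma jointly_continuous_epsP (I : set R) F : jointly_continuous I F <->
  forall t q, I t -> forall e, 0 < e -> exists2 d, 0 < d &
    forall t' q', I t' -> `|t' - t| < d -> `|q' - q| < d ->
      `|F t' q' - F t q| <= e.
Proof.
rewrite /jointly_continuous; split=> [/subspace_continuousP H t q It e e0|H].
- have /cvgrPdist_le /(_ _ e0) := H (t, q) (conj It Logic.I).
  rewrite /= near_withinE => /nbhs_ballP [d /= d0 dP].
  exists d => // t' q' It' td qd; rewrite distrC.
  by apply: (dP (t', q')) => //; split; rewrite /ball /= distrC.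
- apply/subspace_continuousP => -[t q] [/= It _]; apply/cvgrPdist_le => e e0.
  have [d d0 dP] := H t q It e e0.
  rewrite near_withinE; apply/nbhs_ballP; exists d => //= -[t' q'] [/= td qd] [/= It' _].
  by rewrite distrC; apply: dP => //; rewrite distrC.
Qed.

(** * Derivatives of the semigroup orbit *)

Variables (s : R -> R) (U : nat -> R -> R -> R) (N : nat -> R).
Hypothesis s_gt0 : forall q, 0 < s q.
Hypothesis Ss : symbol s 1 s.
Hypothesis Uchain : forall t, 0 <= t -> chain s (fun m => U m t) N.
Hypothesis Utaylor : forall m t r q, 0 <= r -> r <= t ->
  `|U m t q - U m r q - (t - r) * U m.+1 r q| <= (t - r) ^+ 2 * N m.+2.

Let N_ge0 m : 0 <= N m.
Proof. exact: le_trans (normr_ge0 (U m 0 0)) ((Uchain (lexx 0) m).2 0). Qed.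

Let Ugen t m : 0 <= t -> gen s (U m t) (U m.+1 t).
Proof. by move=> t0; exact: (Uchain t0 m).1. Qed.

Let Ubd t m q : 0 <= t -> `|U m t q| <= N m.
Proof. by move=> t0; exact: (Uchain t0 m).2. Qed.

Lemma chain_lipschitz m t r q : 0 <= t -> 0 <= r -> `|t - r| <= 1 ->
  `|U m t q - U m r q| <= `|t - r| * (N m.+1 + N m.+2).
Proof.
wlog rt : t r / r <= t => [H t0 r0 tr|].
  have [rt|/ltW tr'] := leP r t; first exact: H.
  by rewrite distrC [`|t - r|]distrC H // distrC.
move=> t0 r0; rewrite ger0_norm ?subr_ge0 // => tr.
have D0 : 0 <= t - r by rewrite subr_ge0.
have T := Utaylor m q r0 rt.
have B := ler_wpM2l D0 (Ubd m.+1 q r0).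
rewrite -(subrK ((t - r) * U m.+1 r q) (U m t q - U m r q)).
apply: le_trans (ler_normD _ _) _; rewrite normrM (ger0_norm D0).
have := mulr_ge0 (mulr_ge0 D0 (N_ge0 m.+2)) (_ : 0 <= 1 - (t - r)).
by rewrite subr_ge0 => /(_ tr); lra.
Qed.

(** The hypothesis [Utaylor] covers only forward increments. A backward one is expanded at the
    earlier time [t], and the change of base point costs [(t - r)] times an increment of [U m.+1],
    of first order by the Lipschitz bound. *)
Lemma chain_taylor m t r q : 0 <= t -> 0 <= r -> `|t - r| <= 1 ->
  `|U m t q - U m r q - (t - r) * U m.+1 r q|
    <= (t - r) ^+ 2 * (2 * N m.+2 + N m.+3).
Proof.
move=> t0 r0 tr; have N2 := N_ge0 m.+2; have N3 := N_ge0 m.+3.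
have sq := sqr_ge0 (t - r).
have [rt|/ltW tr'] := leP r t.
  by apply: le_trans (Utaylor m q r0 rt) _; rewrite ler_wpM2l //; lra.
have T := Utaylor m q t0 tr'.
have P := chain_lipschitz m.+1 q t0 r0 tr.
have -> : U m t q - U m r q - (t - r) * U m.+1 r q =
  - (U m r q - U m t q - (r - t) * U m.+1 t q) + (t - r) * (U m.+1 t q - U m.+1 r q).
  by ring.
apply: le_trans (ler_normD _ _) _; rewrite normrN normrM.
have P2 := ler_wpM2l (normr_ge0 (t - r)) P.
have E : `|t - r| * `|t - r| = (t - r) ^+ 2 by rewrite -expr2 real_normK ?num_real.
rewrite mulrA E in P2.
have E2 : (r - t) ^+ 2 = (t - r) ^+ 2 by ring.
by rewrite E2 in T; lra.
Qed.

(** As [U a] is the [a]-th time derivative of [U 0], this is the derivative of order [a] in time and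
    [b] in space. *)
Definition mixed a b t : R -> R := derive1n b (U a t).

Lemma finite_bound (M : nat -> R) b : exists B, forall m, (m <= b)%N -> M m <= B.
Proof.
elim: b => [|b [B BP]]; first by exists (M 0%N) => m; rewrite leqn0 => /eqP ->.
exists (Num.max B (M b.+1)) => m; rewrite leq_eqVlt ltnS le_max.
by case/predU1P => [->|/BP ->]; rewrite ?lexx ?orbT.
Qed.

Lemma derive1n_seq (f : nat -> R -> R) b :
  (forall i, has_derivative (f i) (f i.+1)) -> derive1n b (f 0%N) = f b.
Proof.
move=> df; elim: b => [//|b IH].
by apply/funext => q; rewrite derive1nS IH derive1E; have dq := df b q; exact: derive_val.
Qed.

Lemma mixed_bound a b : exists K, forall t q, 0 <= t ->
  `|mixed a b t q| <= K * s q ^ ((0 : int) - b%:Z).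
Proof.
have [K K0 KP] := chain_regularity s_gt0 Ss b.
have [B BP] := finite_bound (fun m => N (a + m)%N) b.
exists (K * B) => t q t0.
have S : symb s b 0 (K * B) (U (a + 0)%N t).
  apply: (KP (fun m => U (a + m)%N t)) => [m|m x mb]; first by rewrite addnS; exact: Ugen.
  by apply: le_trans (Ubd _ _ t0) _; exact: BP.
by rewrite addn0 in S; exact: (symb_derive1n S (leqnn b)).1.
Qed.

Lemma mixed_deriv a b t : 0 <= t -> has_derivative (mixed a b t) (mixed a b.+1 t).
Proof.
move=> t0; have [K K0 KP] := chain_regularity s_gt0 Ss b.+1.
have [B BP] := finite_bound (fun m => N (a + m)%N) b.+1.
have S : symb s b.+1 0 (K * B) (U (a + 0)%N t).
  apply: (KP (fun m => U (a + m)%N t)) => [m|m x mb]; first by rewrite addnS; exact: Ugen.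
  by apply: le_trans (Ubd _ _ t0) _; exact: BP.
rewrite addn0 in S => q; have [_ /(_ (ltnSn b))] := symb_derive1n S (leqnSn b).
exact.
Qed.

(** By linearity the increments in [t] are again linked by A, so [chain_regularity] transfers their
    sup bounds to all space derivatives. *)
Lemma mixed_lipschitz a b : exists K, forall t r q, 0 <= t -> 0 <= r ->
  `|t - r| <= 1 ->
  `|mixed a b t q - mixed a b r q| <= K * `|t - r| * s q ^ ((0 : int) - b%:Z).
Proof.
have [K K0 KP] := chain_regularity s_gt0 Ss b.
have [B BP] := finite_bound (fun m => N (a + m).+1 + N (a + m).+2) b.
exists (K * B) => t r q t0 r0 tr.
have S : symb s b 0 (K * (`|t - r| * B)) (fun x => U (a + 0)%N t x - U (a + 0)%N r x).
  apply: (KP (fun m x => U (a + m)%N t x - U (a + m)%N r x)) => [m|m x mb].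
    by rewrite addnS; apply: gen_sub; exact: Ugen.
  apply: le_trans (chain_lipschitz _ _ t0 r0 tr) _.
  by rewrite ler_wpM2l //; exact: BP.
rewrite addn0 in S; have [/(_ q) + _] := symb_derive1n S (leqnn b).
rewrite (derive1n_seq (f := fun i x => mixed a i t x - mixed a i r x)).
  by rewrite mulrCA -mulrA [_ * (K * B)]mulrC !mulrA.
by move=> i; apply: has_derivativeB; exact: mixed_deriv.
Qed.

Lemma mixed_taylor a b : exists K, forall t r q, 0 <= t -> 0 <= r ->
  `|t - r| <= 1 ->
  `|mixed a b t q - mixed a b r q - (t - r) * mixed a.+1 b r q|
     <= K * s q ^ ((0 : int) - b%:Z) * (t - r) ^+ 2.
Proof.
have [K K0 KP] := chain_regularity s_gt0 Ss b.
have [B BP] := finite_bound (fun m => 2 * N (a + m).+2 + N (a + m).+3) b.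
exists (K * B) => t r q t0 r0 tr.
have S : symb s b 0 (K * ((t - r) ^+ 2 * B))
   (fun x => U (a + 0)%N t x - U (a + 0)%N r x - (t - r) * U (a + 0).+1 r x).
  apply: (KP (fun m x => U (a + m)%N t x - U (a + m)%N r x - (t - r) * U (a + m).+1 r x)) => [m|m x mb].
    rewrite addnS; apply: gen_sub; first by apply: gen_sub; exact: Ugen.
    have h := Ugen (a + m).+1 r0.
    by apply: gen_eq (gen_comb (t - r) 0 h h) _ _ => x; rewrite mul0r addr0.
  apply: le_trans (chain_taylor _ _ t0 r0 tr) _.
  by rewrite ler_wpM2l ?sqr_ge0 //; exact: BP.
rewrite addn0 in S; have [/(_ q) + _] := symb_derive1n S (leqnn b).
rewrite (derive1n_seq (f := fun i x => mixed a i t x - mixed a i r x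
   - (t - r) * mixed a.+1 i r x)).
  by move=> h; apply: le_trans h _; rewrite le_eqVlt; apply/orP; left; apply/eqP; ring.
move=> i; apply: has_derivativeB.
  by apply: has_derivativeB; exact: mixed_deriv.
by apply: has_derivativeZ; exact: mixed_deriv.
Qed.

(** Continuity in [q] at fixed [t], combined with a Lipschitz bound in [t] that is uniform for [q']
    near [q] because the weight is continuous. *)
Lemma mixed_jointly_continuous a b F :
  (forall t q, 0 <= t -> F t q = mixed a b t q) -> jointly_continuous `[0, +oo[ F.
Proof.
move=> FE; apply/jointly_continuous_epsP => t q; rewrite /= in_itv /= andbT => t0 e e0.
have [K KP] := mixed_lipschitz a b.
have e2 : 0 < e / 2 by lra.
have [d1 d10 d1P] := (continuous_epsP _ _).1 (has_derivative_continuous (mixed_deriv a b t0) (x := q)) _ e2.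
have sc : continuous (fun x => s x ^ ((0 : int) - b%:Z)).
  have [s' ds _] := symbol_derive Ss.
  have -> : (fun x => s x ^ ((0 : int) - b%:Z)) = (fun x => (s x ^+ b)^-1).
    by apply/funext => x; rewrite sub0r -exprnN.
  apply: continuous_invf => [x|]; first by rewrite expf_neq0 // gt_eqF.
  exact: continuous_expf (has_derivative_continuous ds).
have [d2 d20 d2P] := (continuous_epsP _ _).1 (sc q) _ (ltr01 : 0 < 1 :> R).
pose S := `|K| * (s q ^ ((0 : int) - b%:Z) + 1).
have S0 : 0 <= S by rewrite mulr_ge0 // addr_ge0 // ltW // exprz_gt0.
exists (Num.min (Num.min 1 (e / 2 / (S + 1))) (Num.min d1 d2)).
  by rewrite !lt_min ltr01 d10 d20 divr_gt0 //; lra.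
move=> t' q'; rewrite /= in_itv /= andbT => t'0.
rewrite !lt_min => /andP[/andP[h1 h2] _] /andP[_ /andP[h3 h4]].
rewrite !FE //; apply: le_trans (ler_distD (mixed a b t q') _ _) _.
have -> : e = e / 2 + e / 2 by field.
apply: lerD (d1P _ h3); apply: le_trans (KP _ _ q' t'0 t0 (ltW h1)) _.
apply: le_trans (_ : S * `|t' - t| <= _); last first.
  rewrite ltr_pdivlMr in h2; last by lra.
  by have := normr_ge0 (t' - t); lra.
rewrite /S mulrAC; apply: ler_wpM2r => //.
have := d2P _ h4; rewrite ler_norml => /andP[_ h5].
have p : 0 < s q' ^ ((0 : int) - b%:Z) by rewrite exprz_gt0.
apply: le_trans (_ : `|K| * s q' ^ ((0 : int) - b%:Z) <= _).
  by rewrite ler_pM2r //; exact: ler_norm.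
by rewrite ler_wpM2l //; lra.
Qed.

Lemma mixed_time a b F t q : (forall t q, 0 <= t -> F t q = mixed a b t q) -> 0 <= t ->
  derivable_t F t q /\ partial_t F t q = mixed a.+1 b t q.
Proof.
move=> FE t0; have [K KP] := mixed_taylor a b.
have PF := time_increments_proper t0.
have H : time_quotient F t q @ time_increments t --> mixed a.+1 b t q.
  apply: (cvg_time_quotient (G := mixed a.+1 b) (K := K * s q ^ ((0 : int) - b%:Z)) t0).
  move=> h h1 th; rewrite !FE //.
  by have := KP (t + h) t q th t0; rewrite addrAC subrr add0r; apply.
split; first by apply/cvg_ex; exists (mixed a.+1 b t q).
exact: cvg_lim H.
Qed.

Lemma mixed_space a b F t q : (forall t q, 0 <= t -> F t q = mixed a b t q) -> 0 <= t ->
  derivable_q F t q /\ partial_q F t q = mixed a b.+1 t q.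
Proof.
move=> FE t0; have FtE : F t = mixed a b t by apply/funext => x; exact: FE.
have dq := mixed_deriv a b t0 q.
by rewrite /derivable_q /partial_q FtE derive1E; case: dq.
Qed.

(** [partial_t] raises [a] and [partial_q] raises [b]. Agreement is asked for [t >= 0] only, as
    [partial_t F] is not controlled at negative times. *)
Lemma mixed_class_C k a b F :
  (forall t q, 0 <= t -> F t q = mixed a b t q) -> class_C k F.
Proof.
elim: k a b F => [|k IH] a b F FE; split=> //; try exact: mixed_jointly_continuous FE.
split.
- by move=> t q t0; split; [case: (mixed_time q FE t0)|case: (mixed_space q FE t0)].
- by apply: (IH a.+1 b) => t q t0; case: (mixed_time q FE t0).
- by apply: (IH a b.+1) => t q t0; case: (mixed_space q FE t0).
Qed.

End TimeRegularity.

(** * Uniqueness *)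

Section Uniqueness.
Context {R : realType}.
Implicit Types (F D : R -> R -> R) (t q h : R).

Lemma derivable_t_eps F t q : derivable_t F t q -> forall e, 0 < e ->
  exists2 d, 0 < d & forall h, `|h| < d -> 0 <= t + h ->
    `|F (t + h) q - F t q - h * partial_t F t q| <= e * `|h|.
Proof.
move=> H e e0; have : time_quotient F t q @ time_increments t --> partial_t F t q by exact: H.
move=> /cvgrPdist_le /(_ _ e0); rewrite /time_increments !near_withinE.
move=> /nbhs_ballP [d /= d0 dP]; exists d => // h hd th.
have [->|h0] := eqVneq h 0; first by rewrite addr0 subrr mul0r subr0 !normr0 mulr0.
have hp : 0 < `|h| by rewrite normr_gt0.
have : ball (0 : R) d h by rewrite /ball /= sub0r normrN.
move=> /dP /(_ h0 th); rewrite distrC.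
have -> : time_quotient F t q h - partial_t F t q =
    (F (t + h) q - F t q - h * partial_t F t q) / h.
  by rewrite /time_quotient; field.
by rewrite normrM normfV ler_pdivrMr.
Qed.

(* Barrier eps e^{(G + 1) t} (1 + q^2). *)
Lemma parabolic_comparison (s C0 : R -> R) (G N : R) D1 D2 :
  0 < G -> (forall q, s q ^+ 2 <= G * (1 + q ^+ 2)) ->
  classical_solution s C0 D1 -> classical_solution s C0 D2 ->
  (forall t q, 0 <= t -> `|D1 t q| <= N) -> (forall t q, 0 <= t -> `|D2 t q| <= N) ->
  forall t q, 0 <= t -> D1 t q <= D2 t q.
Proof.
move=> G0 sG S1 S2 B1 B2 T x T0.
pose E t := expR ((G + 1) * t).
have dE : has_derivative E (fun t => (G + 1) * E t).
  have := has_derivative_comp (fun y => is_derive_expR y)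
    (has_derivativeZ (G + 1) has_derivative_id).
  by move=> h; apply: has_derivative_eq h _ _ => // t; rewrite /E mulr1 mulrC.
have E0 t : 0 < E t by exact: expR_gt0.
have E1 t : 0 <= t -> 1 <= E t.
  by move=> t0; rewrite /E -[leLHS]expR0 ler_expR mulr_ge0 //; lra.
have w0 q : 0 < 1 + q ^+ 2 by have := sqr_ge0 q; lra.
apply/ler_addgt0Pr => e1 e10.
pose e := e1 / (E T * (1 + x ^+ 2)).
have e0 : 0 < e by rewrite divr_gt0 // mulr_gt0.
pose z t q := D1 t q - D2 t q - e * (E t * (1 + q ^+ 2)).
suff : z T x <= 0 by rewrite /z /e divfK ?gt_eqF ?mulr_gt0 //; lra.
rewrite leNgt; apply/negP => zT.
(* The rectangle contains [x], and outside it the barrier exceeds [e Q >= 2 N >= D1 - D2]; a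
   positive maximum over the rectangle is thus global in [q]. *)
pose Q := Num.max (Num.max 1 `|x|) (2 * N / e).
have Q1 : 1 <= Q by rewrite !le_max lexx.
have Qx : `|x| <= Q by rewrite !le_max lexx orbT.
have QN : 2 * N <= e * Q.
  by rewrite [e * _]mulrC -ler_pdivrMr // le_max lexx orbT.
pose A : set (R * R) := `[0, T] `*` `[- Q, Q].
have cz : {within A, continuous (fun y : R * R => z y.1 y.2)}.
  have cD D : classical_solution s C0 D -> {within A, continuous (fun y : R * R => D y.1 y.2)}.
    move=> [cD _ _ _ _]; apply: continuous_subspaceW cD => -[t q] [/= + _].
    by rewrite !in_itv /= andbT => /andP[].
  have cb : continuous (fun y : R * R => e * (E y.1 * (1 + y.2 ^+ 2))).
    have c1 : continuous (fun y : R * R => E y.1).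
      move=> y; apply: (@cvg_comp _ _ _ (fun y : R * R => y.1) E _ (nbhs y.1)).
        exact: cvg_fst.
      exact: has_derivative_continuous dE y.1.
    have c2 : continuous (fun y : R * R => 1 + y.2 ^+ 2).
      move=> y; apply: cvgD; first exact: cvg_cst.
      by apply: cvgM; exact: cvg_snd.
    by move=> y; apply: cvgM; [exact: cvg_cst | apply: cvgM; [exact: c1|exact: c2]].
  move=> y; apply: cvgB; last exact: (continuous_subspaceT cb).
  by apply: cvgB; [exact: (cD _ S1) | exact: (cD _ S2)].
have [||[t0 q0] +] := compact_EVT_max _ _ cz.
- by exists (T, x); split; rewrite /= in_itv /= ?T0 ?lexx // -ler_norml.
- by apply: compact_setX; exact: segment_compact.
rewrite inE => -[/=]; rewrite !in_itv /= => /andP[t00 t0T] /andP[q01 q02] mx.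
have zm : 0 < z t0 q0.
  apply: lt_le_trans zT _; apply: (mx (T, x)); rewrite inE; split.
    by rewrite /= in_itv /= T0 lexx.
  by rewrite /= in_itv /= -ler_norml.
have tpos : 0 < t0.
  rewrite lt_neqAle t00 andbT; apply/eqP => t0E; move: zm.
  rewrite -t0E /z (solution_initial S1) (solution_initial S2) subrr sub0r oppr_gt0.
  have P : 0 < e * (E 0 * (1 + q0 ^+ 2)) by exact: mulr_gt0 e0 (mulr_gt0 (E0 _) (w0 _)).
  by rewrite ltNge (ltW P).
have mq y : z t0 y <= z t0 q0.
  have [yQ|yQ] := leP `|y| Q.
    by apply: (mx (t0, y)); rewrite inE; split; rewrite /= in_itv /= ?t00 // -ler_norml.
  apply: le_trans (ltW zm); rewrite /z.
  have h1 : e * Q <= e * (E t0 * (1 + y ^+ 2)).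
    rewrite ler_pM2l //; apply: le_trans (_ : 1 * (1 + y ^+ 2) <= _); last first.
      by rewrite ler_pM2r //; exact: E1.
    have yy : Q <= y ^+ 2.
      rewrite -real_normK ?num_real // expr2; apply: le_trans (ltW yQ) _.
      by rewrite ler_peMl // (le_trans Q1) // ltW.
    by rewrite mul1r; lra.
  have := B1 t0 y t00; have := B2 t0 y t00; rewrite !ler_norml => /andP[? ?] /andP[? ?].
  lra.
have d1 : has_derivative (D1 t0) (partial_q D1 t0).
  move=> y; rewrite /partial_q derive1E; apply: derivableP.
  by have [_ h _] := solution_derivable S1 y tpos.
have d2 : has_derivative (D2 t0) (partial_q D2 t0).
  move=> y; rewrite /partial_q derive1E; apply: derivableP.
  by have [_ h _] := solution_derivable S2 y tpos.
have dw : has_derivative (fun y : R => 1 + y ^+ 2) (fun y => 2 * y).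
  apply: has_derivative_eq (has_derivativeD (has_derivative_cst 1)
    (has_derivativeM has_derivative_id has_derivative_id)) _ _ => y //=.
  ring.
have dz : has_derivative (z t0)
    (fun y => partial_q D1 t0 y - partial_q D2 t0 y - e * (E t0 * (2 * y))).
  apply: has_derivativeB; first exact: has_derivativeB.
  by do 2 apply: has_derivativeZ.
have ddz : is_derive q0 (1 : R)
    (fun y => partial_q D1 t0 y - partial_q D2 t0 y - e * (E t0 * (2 * y)))
    (partial_q (partial_q D1) t0 q0 - partial_q (partial_q D2) t0 q0 - e * (E t0 * 2)).
  apply: is_deriveB; first apply: is_deriveB.
  - rewrite [partial_q (partial_q D1) _ _]derive1E; apply: derivableP.
    by have [_ _ h] := solution_derivable S1 q0 tpos.
  - rewrite [partial_q (partial_q D2) _ _]derive1E; apply: derivableP.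
    by have [_ _ h] := solution_derivable S2 q0 tpos.
  have h := has_derivativeZ e (has_derivativeZ (E t0) (has_derivativeZ 2 has_derivative_id)).
  by have := h q0; rewrite mulr1.
have [_ zqq] := second_derivative_at_max dz ddz mq.
have e1' := solution_equation S1 q0 tpos; have e2' := solution_equation S2 q0 tpos.
rewrite /solves_equation in e1' e2'.
set l1 := partial_t D1 t0 q0 in e1'; set l2 := partial_t D2 t0 q0 in e2'.
pose w := 1 + q0 ^+ 2.
(* The second-order condition bounds the difference of the second space derivatives by [2 e E t0];
   the equation and the growth of [s^2] do the rest. *)
have lw : l1 - l2 <= e * (E t0 * (G * w)).
  rewrite e1' e2' -mulrBr.
  have p : 0 <= 2^-1 * s q0 ^+ 2 by rewrite mulr_ge0 ?sqr_ge0 ?invr_ge0.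
  apply: le_trans (_ : 2^-1 * s q0 ^+ 2 * (e * (E t0 * 2)) <= _).
    by rewrite ler_wpM2l // -subr_le0.
  have -> : 2^-1 * s q0 ^+ 2 * (e * (E t0 * 2)) = e * (E t0 * s q0 ^+ 2) by field.
  by rewrite !ler_pM2l.
have w1 : 0 < w by exact: w0.
(* The barrier grows at rate [(G + 1) e E w], against at most [G e E w] for [D1 - D2]. The precision
   [k] keeps the first-order errors [k n (2 + e w)] of a backward time step [n] below the gap
   [e E w n], so [z] would be larger at [t0 - n]. *)
pose k := e * (E t0 * w) / (4 * (1 + e * w)).
have ew : 0 < e * w by rewrite mulr_gt0.
have k4 : 0 < 4 * (1 + e * w) by rewrite mulr_gt0 // addr_gt0.
have k0 : 0 < k by exact: divr_gt0 (mulr_gt0 e0 (mulr_gt0 (E0 _) w1)) k4.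
have kE : k * (4 * (1 + e * w)) = e * (E t0 * w) by rewrite /k divfK // (gt_eqF k4).
have [dt1 _ _] := solution_derivable S1 q0 tpos.
have [dt2 _ _] := solution_derivable S2 q0 tpos.
have [r1 r10 r1P] := derivable_t_eps dt1 k0.
have [r2 r20 r2P] := derivable_t_eps dt2 k0.
have [r3 r30 r3P] := (is_derive_epsP _ _ _).1 (dE t0) _ k0.
have [n n0 [n1 n2 n3 n4]] : exists2 n, 0 < n & [/\ n < r1, n < r2, n < r3 & n <= t0].
  pose m := Num.min (Num.min r1 r2) (Num.min r3 t0).
  have m0 : 0 < m by rewrite !lt_min r10 r20 r30.
  have nm : m / 2 < m by rewrite ltr_pdivrMr // ltr_pMr // ltr1n.
  exists (m / 2); first by rewrite divr_gt0.
  by split; [| | |apply: ltW]; apply: lt_le_trans nm _; rewrite !ge_min lexx ?orbT.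
have nn : `|- n| = n by rewrite normrN gtr0_norm.
have th : 0 <= t0 + - n by rewrite subr_ge0.
have := r1P (- n); have := r2P (- n); have := r3P (- n).
rewrite nn -/l1 -/l2 => /(_ n3) h3 /(_ n2 th) h2.
move=> /(_ n1 th) h1.
have zz : z (t0 + - n) q0 <= z t0 q0.
  apply: (mx (t0 + - n, q0)); rewrite inE; split; rewrite /= in_itv /=.
    by rewrite th (le_trans _ t0T) // gerBl ltW.
  by rewrite q01.
rewrite /z -/w in zz; clearbody w k l1 l2.
move: h1 h2 h3; rewrite !ler_norml => /andP[h1 _] /andP[_ h2] /andP[_ h3].
have h3' := ler_wpM2l (ltW ew) h3.
have lwn := ler_wpM2r (ltW n0) lw.
have kn : k * n * (4 * (1 + e * w)) = e * (E t0 * w) * n by rewrite -kE; ring.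
have p1 := mulr_gt0 (mulr_gt0 e0 (mulr_gt0 (E0 t0) w1)) n0.
have p2 := mulr_gt0 k0 n0; have p3 := mulr_gt0 p2 ew.
clear -zz h1 h2 h3' lwn kn p1 p2 p3; lra.
Qed.

Lemma bounded_solutionP F : bounded_solution F <->
  exists N, forall t q, 0 <= t -> `|F t q| <= N.
Proof.
split=> [[M [_ HM]]|[N HN]].
  exists (M + 1) => t q t0; apply: (HM (M + 1) _ (t, q)); first by rewrite ltrDl.
  by split=> //=; rewrite in_itv /= t0.
exists N; split; first exact: num_real.
move=> M NM [t q] [/=]; rewrite in_itv /= andbT => t0 _.
exact: le_trans (HN t q t0) (ltW NM).
Qed.

Lemma classical_solution_uniq (s C0 : R -> R) (G : R) D1 D2 :
  0 < G -> (forall q, s q ^+ 2 <= G * (1 + q ^+ 2)) ->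
  classical_solution s C0 D1 -> classical_solution s C0 D2 ->
  bounded_solution D1 -> bounded_solution D2 ->
  forall t q, 0 <= t -> D1 t q = D2 t q.
Proof.
move=> G0 sG S1 S2 /bounded_solutionP [N1 B1] /bounded_solutionP [N2 B2] t q t0.
have b1 t' q' : 0 <= t' -> `|D1 t' q'| <= Num.max N1 N2.
  by move=> /B1 h; rewrite le_max h.
have b2 t' q' : 0 <= t' -> `|D2 t' q'| <= Num.max N1 N2.
  by move=> /B2 h; rewrite le_max h orbT.
by apply/eqP; rewrite eq_le (parabolic_comparison G0 sG S1 S2 b1 b2) //
  (parabolic_comparison G0 sG S2 S1 b2 b1).
Qed.

End Uniqueness.

(** * The Cauchy problem *)

Lemma heat_semigroup_exists (R : realType) (s f : R -> R) :
  (forall q, 0 < s q) -> symbol s 1 s -> symbol s 0 f ->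
  exists (U : nat -> R -> R -> R) (N : nat -> R),
  [/\ forall t, 0 <= t -> chain s (fun m => U m t) N,
      U 0%N 0 = f
    & forall m t r q, 0 <= r -> r <= t ->
        `|U m t q - U m r q - (t - r) * U m.+1 r q| <= (t - r) ^+ 2 * N m.+2].
Proof.
move=> s_gt0 Ss Sf; have [s' [L [ds Ss' L0 s'L]]] := symbol_lipschitz Ss.
have [s2 ds' _] := symbol_derive Ss'.
have [W [N [W0 WN]]] := symbol_chain s_gt0 Ss Sf.
have [|t g t0 tt h|U [U1 U2 U3]] := semigroup_exists (tau_max_gt0 s L0) _ _ WN.
- move=> u g t N0 c ug uN t0 tt.
  (* [tau_maxP] concerns positive steps; at [t = 0] accretivity is trivial. *)
  have [<-|tn0] := eqVneq 0 t.
    by move=> H q; have := H q; rewrite mul0r subr0.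
  apply: (gen_bound s_gt0 ds s'L ug uN t0).
  by have [] := @tau_maxP _ s L L0 t _ tt; rewrite // lt_neqAle tn0.
- exact: (heat_resolvent_exists s_gt0 ds ds' L0 s'L t0 tt h).
by exists U, N; split=> //; rewrite U2 W0.
Qed.

Unset Implicit Arguments.

Theorem theorem9 (R : realType) (gamma : R) (sigma sigma0 sigmab C0 : R -> R)
    (hsigma : diffusion_coefficient gamma sigma sigma0 sigmab)
    (hC0 : initial_condition sigma0 C0) :
  exists C : R -> R -> R,
    [/\ [/\ classical_solution sigma C0 C,
            forall t q, 0 <= t -> solves_equation sigma C t q,
            smooth C
          & bounded_solution C],
        forall D : R -> R -> R,
          classical_solution sigma C0 D -> bounded_solution D ->
          forall t q, 0 <= t -> D t q = C t q
      & forall n : nat, (0 < n)%N ->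
          exists K : R -> R,
            [/\ forall t, 0 <= t -> 0 <= K t,
                {within `[0, +oo[, continuous K}
              & forall t q, 0 <= t -> q != 0 \/ gamma = 0 ->
                  `|derive1n n (C t) q| <= K t * `|q| `^ (- (n%:R * gamma / 2))]].
Proof.
have s_gt0 := sigma_gt0 hsigma; have Ss := symbol_sigma hsigma.
have [U [N [Uc U0 Ut]]] := heat_semigroup_exists s_gt0 Ss (symbol_initial hsigma hC0).
have [s' [L [ds _ L0 s'L]]] := symbol_lipschitz Ss.
pose C := U 0%N.
have CE t q : 0 <= t -> C t q = mixed U 0 0 t q by [].
have time F a b t q := @mixed_time _ sigma U N s_gt0 Ss Uc Ut a b F t q.
have space F a b t q := @mixed_space _ sigma U N s_gt0 Ss Uc a b F t q.
have qE t q : 0 <= t -> partial_q C t q = mixed U 0 1 t q.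
  by move=> t0; case: (space C 0%N 0%N t q CE t0).
have qqE t q : 0 <= t -> partial_q (partial_q C) t q = mixed U 0 2 t q.
  by move=> t0; case: (space _ 0%N 1%N t q qE t0).
have tE t q : 0 <= t -> partial_t C t q = U 1%N t q.
  by move=> t0; case: (time C 0%N 0%N t q CE t0).
have Csmooth : smooth C.
  by move=> k; exact: (mixed_class_C s_gt0 Ss Uc Ut _ CE).
have Ceq t q : 0 <= t -> solves_equation sigma C t q.
  move=> t0; rewrite /solves_equation tE // qqE //.
  (* The relation A U_0 = U_1 is the equation once the derivatives in [gen] are identified with
     [mixed] by uniqueness. *)
  have [p dp d2p] := (Uc t t0 0%N).1.
  have m1 := mixed_deriv s_gt0 Ss Uc 0 0 t0.
  have m2 := mixed_deriv s_gt0 Ss Uc 0 1 t0.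
  rewrite (has_derivative_uniq m1 dp) in m2.
  rewrite (has_derivative_uniq m2 d2p).
  by field; rewrite gt_eqF.
have Ccl : classical_solution sigma C0 C.
  have sub F : jointly_continuous `[0, +oo[ F -> jointly_continuous `]0, +oo[ F.
    apply: continuous_subspaceW => -[t q] [/= + _].
    by rewrite !in_itv /= !andbT => /ltW.
  have [c0 [_ [c1 _] [c2 [_ _ [c3 _]]]]] := Csmooth 2%N.
  split=> [//|t q /ltW t0||t q /ltW|q].
  - split.
    + by case: (time C 0%N 0%N t q CE t0).
    + by case: (space C 0%N 0%N t q CE t0).
    + by case: (space _ 0%N 1%N t q qE t0).
  - by split; exact: sub.
  - exact: Ceq.
  - by rewrite /C U0.
have Cb : bounded_solution C.
  by apply/bounded_solutionP; exists (N 0%N) => t q t0; exact: (Uc t t0 0%N).2.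
exists C; split=> [||n _]; first by split.
  move=> D Dcl Db; apply: (classical_solution_uniq _ (sqr_le_growth s_gt0 ds s'L) Dcl Ccl) => //.
  exact: growth_gt0.
have [K KP] := mixed_bound s_gt0 Ss Uc 0 n.
have [M M0 MP] := sigma_weight_bound hsigma n.
(* [K] bounds the derivative weighted by [sigma^n] uniformly in time and [M] converts the weight;
   the absolute value makes the constant non-negative. *)
exists (fun=> `|K| * M); split=> [t _||t q t0 hq].
- by rewrite mulr_ge0.
- by apply: continuous_subspaceT => x; exact: cst_continuous.
rewrite -[_ * M * _]mulrA; apply: le_trans (ler_wpM2l (normr_ge0 K) (MP q hq)).
apply: le_trans (KP t q t0) _.
by rewrite ler_wpM2r ?ler_norm // ltW // exprz_gt0.
Qed.
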